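(* Let $n\in\mathbb N$, let $x_1,\ldots,x_n,y_1,\ldots,y_n,z_0$ be non-zero parameters (writing $\overline{w}=w^{-1}$), and let $\lambda$ be a strict partition with exactly $n$ non-zero parts. For $1\le k,\ell\le n$ put $$f_{k,\ell}(q_\ell)=\frac{u_kq_\ell}{1-x_kq_\ell}\prod_{i=k+1}^n\frac{1+y_iq_\ell}{1-x_iq_\ell}\cdot\frac{1+\overline{z}_0q_\ell}{1-z_0q_\ell}\cdot\prod_{i=1}^n\frac{1+\overline{x}_iq_\ell}{1-\overline{y}_iq_\ell},\qquad g_{k,\ell}(q_\ell)=\frac{q_\ell}{1-\overline{y}_kq_\ell}\prod_{i=1}^{k-1}\frac{1+\overline{x}_iq_\ell}{1-\overline{y}_iq_\ell},$$ where $u_k=z_0x_k\prod_{i=k+1}^n x_i\overline{y}_i$, and $h_{k,\ell}(q_\ell)=f_{k,\ell}(q_\ell)+(-1)^{n-k}g_{k,\ell}(q_\ell)$. Then $$\sum_{P\in\mathcal P^\lambda(2n+1)}\mathrm{wgt}(P)=[q^\lambda]\det_{1\le k,\ell\le n}\big(h_{k,\ell}(q_\ell)\big),$$ where $[q^\lambda]$ denotes the coefficient of $q_1^{\lambda_1}q_2^{\lambda_2}\cdots q_n^{\lambda_n}$ in the expansion as a formal power series in $q_1,\ldots,q_n$.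
   Context: Consider the totally ordered alphabet $1'<1<2'<2<\cdots<n'<n<0'<0<\overline{n}'<\overline{n}<\cdots<\overline{2}'<\overline{2}<\overline{1}'<\overline{1}$; letters with a prime are ''primed'', the others ''unprimed''. For a strict partition $\lambda=(\lambda_1>\cdots>\lambda_n>0)$ the shifted diagram consists of boxes $(i,j)$ with $1\le i\le n$, $i\le j\le i+\lambda_i-1$; the boxes $(i,i)$ form the main diagonal, and a diagonal is a set of boxes with $j-i$ fixed. $\mathcal P^\lambda(2n+1)$ is the set of fillings $P$ of the shifted diagram by letters of the alphabet such that: entries weakly increase along rows (left to right) and down columns; entries strictly increase along diagonals (from $(i,j)$ to $(i+1,j+1)$); no two equal primed letters lie in the same row; no two equal unprimed letters lie in the same column; all main-diagonal entries are unprimed and for each $k=1,\ldots,n$ exactly one of $k,\overline{k}$ appears on the main diagonal. The weight is $\mathrm{wgt}(P)=\prod_{e\in P}\mathrm{wgt}(e)$ where: a main-diagonal entry $k$ has weight $z_0x_k\prod_{j>k}x_j\overline{y}_j$ and a main-diagonal entry $\overline{k}$ has weight $1$; off the main diagonal, $k\mapsto x_k$, $k'\mapsto y_k$, $\overline{k}\mapsto\overline{y}_k$, $\overline{k}'\mapsto\overline{x}_k$, $0\mapsto z_0$, $0'\mapsto\overline{z}_0$. *)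

(* Defs.v *)
From HB Require Import structures.
From mathcomp Require Import all_boot all_order all_algebra.
From mathcomp Require Import boolp.
From mathcomp Require Export mpoly.

Set Implicit Arguments.
Unset Strict Implicit.
Unset Printing Implicit Defensive.

Import GRing.Theory.

Local Open Scope ring_scope.

Record fps (n : nat) (R : Type) := FPS { fcoef : 'X_{1..n} -> R }.

Lemma fpsP n (R : Type) (f g : fps n R) : fcoef f =1 fcoef g <-> f = g.
Proof.
split=> [|->] //; case: f g => f [g] /= e.
by congr FPS; apply: funext.
Qed.

HB.instance Definition _ n (R : Type) := gen_eqMixin (fps n R).
HB.instance Definition _ n (R : Type) := gen_choiceMixin (fps n R).

Section FPSRing.
Variables (n : nat) (R : comNzRingType).
Implicit Types (f g h : fps n R) (m : 'X_{1..n}) (a b : R).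

Definition fps_zero : fps n R := FPS (fun=> 0).
Definition fps_opp f : fps n R := FPS (fun m => - fcoef f m).
Definition fps_add f g : fps n R := FPS (fun m => fcoef f m + fcoef g m).

(* The degree bound only makes the Cauchy sum range over a finite type:
   k.1 + k.2 = m already forces mdeg k.1, mdeg k.2 <= mdeg m. *)
Definition fps_mul f g : fps n R :=
  FPS (fun m => \sum_(k : 'X_{1..n < (mdeg m).+1, (mdeg m).+1}
                       | m == (k.1 + k.2)%MM) fcoef f k.1 * fcoef g k.2).
Definition fps_one : fps n R := FPS (fun m => (m == 0%MM)%:R).
Definition fps_scale a f : fps n R := FPS (fun m => a * fcoef f m).

Fact fps_addA : associative fps_add.
Proof. by move=> f g h; apply/fpsP => m /=; rewrite addrA. Qed.
Fact fps_addC : commutative fps_add.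
Proof. by move=> f g; apply/fpsP => m /=; rewrite addrC. Qed.
Fact fps_add0 : left_id fps_zero fps_add.
Proof. by move=> f; apply/fpsP => m /=; rewrite add0r. Qed.
Fact fps_addN : left_inverse fps_zero fps_opp fps_add.
Proof. by move=> f; apply/fpsP => m /=; rewrite addNr. Qed.

HB.instance Definition _ :=
  GRing.isZmodule.Build (fps n R) fps_addA fps_addC fps_add0 fps_addN.

Fact fps_scaleA a b f :
  fps_scale a (fps_scale b f) = fps_scale (a * b) f.
Proof. by apply/fpsP => m /=; rewrite mulrA. Qed.
Fact fps_scale1 : left_id 1 fps_scale.
Proof. by move=> f; apply/fpsP => m /=; rewrite mul1r. Qed.
Fact fps_scaleDr : right_distributive fps_scale +%R.
Proof. by move=> a f g; apply/fpsP => m /=; rewrite mulrDr. Qed.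
Fact fps_scaleDl f : {morph fps_scale^~ f : a b / a + b}.
Proof. by move=> a b; apply/fpsP => m /=; rewrite mulrDl. Qed.

HB.instance Definition _ :=
  GRing.Zmodule_isLmodule.Build R (fps n R)
    fps_scaleA fps_scale1 fps_scaleDr fps_scaleDl.

Definition fps_trunc d f : {mpoly R[n]} :=
  \sum_(k : 'X_{1..n < d}) fcoef f k *: 'X_[k].

Lemma mcoeff_fps_trunc d f m :
  (mdeg m < d)%N -> (fps_trunc d f)@_m = fcoef f m.
Proof. exact: mcoeff_mpoly. Qed.

Lemma fcoef_mul_mpoly f g m (p q : {mpoly R[n]}) :
    (forall k, (mdeg k <= mdeg m)%N -> p@_k = fcoef f k) ->
    (forall k, (mdeg k <= mdeg m)%N -> q@_k = fcoef g k) ->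
  fcoef (fps_mul f g) m = (p * q)@_m.
Proof.
move=> hp hq; rewrite mcoeffM /=; apply: eq_bigr => k _.
by rewrite hp ?hq // -ltnS bmdeg.
Qed.

Lemma fcoef_mul_trunc d f g m : (mdeg m < d)%N ->
  fcoef (fps_mul f g) m = (fps_trunc d f * fps_trunc d g)@_m.
Proof.
move=> lt_md; apply: fcoef_mul_mpoly => k le_km;
  by rewrite mcoeff_fps_trunc // (leq_ltn_trans le_km).
Qed.

Fact fps_mulA : associative fps_mul.
Proof.
move=> f g h; apply/fpsP => m; pose T := fps_trunc (mdeg m).+1.
rewrite (fcoef_mul_mpoly (p := T f) (q := T g * T h)); first last.
- by move=> k le_km; rewrite (@fcoef_mul_trunc (mdeg m).+1).
- by move=> k le_km; rewrite mcoeff_fps_trunc.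
rewrite (fcoef_mul_mpoly (p := T f * T g) (q := T h)) ?mulrA //.
- by move=> k le_km; rewrite (@fcoef_mul_trunc (mdeg m).+1).
- by move=> k le_km; rewrite mcoeff_fps_trunc.
Qed.

Fact fps_mulC : commutative fps_mul.
Proof.
move=> f g; apply/fpsP => m.
by rewrite !(@fcoef_mul_trunc (mdeg m).+1) // mulrC.
Qed.

Fact fps_mul1 : left_id fps_one fps_mul.
Proof.
move=> f; apply/fpsP => m.
rewrite (fcoef_mul_mpoly (p := 1) (q := fps_trunc (mdeg m).+1 f)).
- by rewrite mul1r mcoeff_fps_trunc.
- by move=> k _; rewrite mcoeff1.
- by move=> k le_km; rewrite mcoeff_fps_trunc.
Qed.

Fact fps_mulDl : left_distributive fps_mul fps_add.
Proof.
move=> f g h; apply/fpsP => m /=; rewrite -big_split /=.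
by apply: eq_bigr => k _; rewrite mulrDl.
Qed.

Fact fps_one_neq0 : fps_one != 0 :> fps n R.
Proof.
apply/eqP => /fpsP /(_ 0%MM) /= /eqP.
by rewrite eqxx oner_eq0.
Qed.

HB.instance Definition _ :=
  GRing.Zmodule_isComNzRing.Build (fps n R)
    fps_mulA fps_mulC fps_mul1 fps_mulDl fps_one_neq0.

Fact fps_scaleAl a f g : a *: (f * g) = (a *: f) * g.
Proof.
apply/fpsP => m /=; rewrite mulr_sumr.
by apply: eq_bigr => k _; rewrite mulrA.
Qed.

HB.instance Definition _ :=
  GRing.Lmodule_isLalgebra.Build R (fps n R) fps_scaleAl.
HB.instance Definition _ := GRing.Lalgebra_isComAlgebra.Build R (fps n R).

Lemma fcoefD f g m : fcoef (f + g) m = fcoef f m + fcoef g m.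
Proof. by []. Qed.
Lemma fcoefN f m : fcoef (- f) m = - fcoef f m.
Proof. by []. Qed.
Lemma fcoefZ a f m : fcoef (a *: f) m = a * fcoef f m.
Proof. by []. Qed.
Lemma fcoef1 m : fcoef (1 : fps n R) m = (m == 0%MM)%:R.
Proof. by []. Qed.
Lemma fcoefM f g m :
  fcoef (f * g) m =
    \sum_(k : 'X_{1..n < (mdeg m).+1, (mdeg m).+1} | m == (k.1 + k.2)%MM)
      fcoef f k.1 * fcoef g k.2.
Proof. by []. Qed.

Lemma fcoef_sum I (r : seq I) (P : pred I) (E : I -> fps n R) m :
  fcoef (\sum_(i <- r | P i) E i) m = \sum_(i <- r | P i) fcoef (E i) m.
Proof. by elim/big_rec2: _ => // i x y _ <-. Qed.

Lemma fcoefM_eq f f' g m :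
    (forall k, (mdeg k <= mdeg m)%N -> fcoef f k = fcoef f' k) ->
  fcoef (f * g) m = fcoef (f' * g) m.
Proof.
move=> e; rewrite !fcoefM; apply: eq_bigr => k _.
by rewrite e // -ltnS bmdeg.
Qed.

Lemma fcoefM0 f g : fcoef (f * g) 0%MM = fcoef f 0%MM * fcoef g 0%MM.
Proof.
rewrite (fcoef_mul_trunc _ _ (d := 1)) ?mdeg0 //.
by rewrite rmorphM /= !mcoeff_fps_trunc ?mdeg0.
Qed.

Lemma fcoefX_lt w k m :
  fcoef w 0%MM = 0 -> (mdeg m < k)%N -> fcoef (w ^+ k) m = 0.
Proof.
move=> w0; elim: k m => // k IHk m lt_mk.
rewrite exprS fcoefM big1 // => -[[k1 h1] [k2 h2]] /= /eqP def_m.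
have [->|nz_k1] := eqVneq k1 0%MM; first by rewrite w0 mul0r.
rewrite IHk ?mulr0 //; move: lt_mk; rewrite def_m mdegD ltnS.
by apply: leq_trans; rewrite -addn1 addnC leq_add2r lt0n mdeg_eq0.
Qed.

Definition fvar (i : 'I_n) : fps n R := FPS (fun m => (m == U_(i)%MM)%:R).

End FPSRing.

Section FPSInv.
Variables (n : nat) (R : comUnitRingType).
Implicit Types (f g : fps n R) (m : 'X_{1..n}).

Definition fps_unit f := fcoef f 0%MM \is a GRing.unit.

(* If c is the constant coefficient of f and w := 1 - f / c, the inverse of f
   is c^-1 * \sum_k w ^+ k; w has no constant term, so that the powers k with
   k > mdeg m do not contribute to the coefficient of m. *)
Definition fps_inv f : fps n R :=
  if fcoef f 0%MM \is a GRing.unit then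
    let c := (fcoef f 0%MM)^-1 in
    FPS (fun m => c * \sum_(k < (mdeg m).+1) fcoef ((1 - c *: f) ^+ k) m)
  else f.

Fact fps_mulVf f : fps_unit f -> fps_inv f * f = 1.
Proof.
rewrite /fps_unit /fps_inv => u; rewrite u /=.
set c := (fcoef f _)^-1; set w := 1 - c *: f.
have w0 : fcoef w 0%MM = 0.
  by rewrite fcoefD fcoefN fcoefZ fcoef1 eqxx mulVr // subrr.
have def_f : c *: f = 1 - w by rewrite /w opprB addrC subrK.
apply/fpsP => m; pose s := \sum_(k < (mdeg m).+1) w ^+ k.
rewrite (@fcoefM_eq _ _ _ (c *: s)) => [|k le_km]; last first.
  rewrite fcoefZ fcoef_sum /=; congr (_ * _).
  rewrite -!(big_mkord xpredT (fun i => fcoef (w ^+ i) k)).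
  rewrite [in RHS](big_cat_nat (n := (mdeg k).+1)) //= [X in _ + X]big_nat_cond.
  rewrite [X in _ + X]big1 ?addr0 // => i; rewrite andbT => /andP[lt_ki _].
  exact: fcoefX_lt.
rewrite -scalerAl scalerAr def_f mulrC.
have -> : (1 - w) * s = 1 - w ^+ (mdeg m).+1.
  rewrite -{2}(expr1n _ (mdeg m).+1) subrXX /s; congr (_ * _).
  by apply: eq_bigr => i _; rewrite expr1n mul1r.
by rewrite fcoefD fcoefN fcoefX_lt // subr0.
Qed.

Fact fps_unitP f g : g * f = 1 -> fps_unit f.
Proof.
move=> /fpsP /(_ 0%MM); rewrite fcoefM0 fcoef1 eqxx => e.
by apply/unitrPr; exists (fcoef g 0%MM); rewrite mulrC.
Qed.

Fact fps_inv_out : {in [predC fps_unit], fps_inv =1 id}.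
Proof.
by move=> f; rewrite inE unfold_in /= /fps_unit /fps_inv => /negbTE ->.
Qed.

HB.instance Definition _ :=
  GRing.ComNzRing_hasMulInverse.Build (fps n R) fps_mulVf fps_unitP fps_inv_out.

Lemma fps_unit1B (a : R) (i : 'I_n) : 1 - a *: fvar R i \is a GRing.unit.
Proof.
rewrite unfold_in /= /fps_unit fcoefD fcoefN fcoefZ fcoef1 eqxx /=.
by rewrite eq_sym mnm1_eq0 mulr0 subr0 unitr1.
Qed.

End FPSInv.

(* Letters: a symbol together with a flag telling whether it is primed. Indices
   are 0-based throughout: k : 'I_n stands for k + 1. *)

Variant symbol (n : nat) := Unbar of 'I_n | Zero | Bar of 'I_n.
Arguments Zero {n}.

Definition symbol_code n (s : symbol n) : 'I_n + option 'I_n :=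
  match s with Unbar k => inl k | Zero => inr None | Bar k => inr (Some k) end.
Definition symbol_decode n (s : 'I_n + option 'I_n) : symbol n :=
  match s with inl k => Unbar k | inr None => Zero | inr (Some k) => Bar k end.
Lemma symbol_codeK n : cancel (@symbol_code n) (@symbol_decode n).
Proof. by case. Qed.

HB.instance Definition _ n := Equality.copy (symbol n) (can_type (@symbol_codeK n)).
HB.instance Definition _ n := Choice.copy (symbol n) (can_type (@symbol_codeK n)).
HB.instance Definition _ n := Countable.copy (symbol n) (can_type (@symbol_codeK n)).
HB.instance Definition _ n := Finite.copy (symbol n) (can_type (@symbol_codeK n)).

Definition letter (n : nat) : Type := (symbol n * bool)%type.
HB.instance Definition _ n := Finite.on (letter n).

Definition primed n (a : letter n) : bool := a.2.

Definition symbol_rank n (s : symbol n) : nat :=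
  match s with Unbar k => k | Zero => n | Bar k => (2 * n - k)%N end.

(* Position in the order 1' < 1 < ... < n' < n < 0' < 0 < nbar' < nbar < ... *)
Definition letter_rank n (a : letter n) : nat :=
  (2 * symbol_rank a.1 + ~~ primed a)%N.

Definition letter_le n (a b : letter n) : bool :=
  (letter_rank a <= letter_rank b)%N.
Definition letter_lt n (a b : letter n) : bool :=
  (letter_rank a < letter_rank b)%N.

Definition strict_partition n (lam : n.-tuple nat) : bool :=
  sorted gtn lam && all (fun p => 0 < p)%N lam.

Section Tableaux.
Variables (n : nat) (lam : n.-tuple nat).

(* Tagged c of row i is the box (i, i + c) of the shifted diagram. *)
Definition box : Type := {i : 'I_n & 'I_(tnth lam i)}.
HB.instance Definition _ := Finite.on box.

Definition box_row (b : box) : nat := tag b.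
Definition box_col (b : box) : nat := (tag b + tagged b)%N.
Definition on_diag (b : box) : bool := box_row b == box_col b.

Definition filling : Type := {ffun box -> letter n}.
HB.instance Definition _ := Finite.on filling.

Implicit Type P : filling.

Definition rows_weak P : bool :=
  [forall b : box, forall c : box,
     (box_row b == box_row c) && (box_col b <= box_col c)%N ==> letter_le (P b) (P c)].

Definition cols_weak P : bool :=
  [forall b : box, forall c : box,
     (box_col b == box_col c) && (box_row b <= box_row c)%N ==> letter_le (P b) (P c)].

Definition diags_strict P : bool :=
  [forall b : box, forall c : box,
     (box_row c == (box_row b).+1) && (box_col c == (box_col b).+1) ==> letter_lt (P b) (P c)].

Definition rows_primed_once P : bool :=
  [forall b : box, forall c : box,
     [&& box_row b == box_row c, b != c & primed (P b)] ==> (P b != P c)].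

Definition cols_unprimed_once P : bool :=
  [forall b : box, forall c : box,
     [&& box_col b == box_col c, b != c & ~~ primed (P b)] ==> (P b != P c)].

Definition diag_unprimed P : bool :=
  [forall b : box, on_diag b ==> ~~ primed (P b)].

Definition appears_on_diag P (a : letter n) : bool :=
  [exists b : box, on_diag b && (P b == a)].

Definition diag_exactly_one P : bool :=
  [forall k : 'I_n,
     appears_on_diag P (Unbar k, false) (+) appears_on_diag P (Bar k, false)].

Definition tableau P : bool :=
  [&& rows_weak P, cols_weak P, diags_strict P, rows_primed_once P,
      cols_unprimed_once P, diag_unprimed P & diag_exactly_one P].

End Tableaux.

Section Weights.
Variables (n : nat) (F : fieldType) (x y : 'I_n -> F) (z0 : F).

Definition u_ (k : 'I_n) : F := z0 * x k * \prod_(j < n | (k < j)%N) (x j / y j).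

(* Only the unprimed letters k and kbar occur on the main diagonal of a
   tableau; the value on other letters is irrelevant. *)
Definition diag_wgt (a : letter n) : F :=
  match a.1 with Unbar k => u_ k | _ => 1 end.

Definition offdiag_wgt (a : letter n) : F :=
  match a with
  | (Unbar k, false) => x k
  | (Unbar k, true) => y k
  | (Bar k, false) => (y k)^-1
  | (Bar k, true) => (x k)^-1
  | (Zero, false) => z0
  | (Zero, true) => z0^-1
  end.

Definition wgt (lam : n.-tuple nat) (P : filling lam) : F :=
  \prod_(b : box lam)
    (if on_diag b then diag_wgt (P b) else offdiag_wgt (P b)).

(* The quotients below are taken in the ring of formal power series, where
   1 - a q is invertible with inverse the geometric series. *)

Definition f_ (k l : 'I_n) : fps n F :=
  let q := fvar F l in
  (u_ k *: q) / (1 - x k *: q)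
  * \prod_(i < n | (k < i)%N) ((1 + y i *: q) / (1 - x i *: q))
  * ((1 + z0^-1 *: q) / (1 - z0 *: q))
  * \prod_(i < n) ((1 + (x i)^-1 *: q) / (1 - (y i)^-1 *: q)).

Definition g_ (k l : 'I_n) : fps n F :=
  let q := fvar F l in
  q / (1 - (y k)^-1 *: q)
  * \prod_(i < n | (i < k)%N) ((1 + (x i)^-1 *: q) / (1 - (y i)^-1 *: q)).

(* With 0-based k, the exponent n - k becomes n - k.+1. *)
Definition h_ (k l : 'I_n) : fps n F :=
  f_ k l + (-1) ^+ (n - k.+1) * g_ k l.

End Weights.

(* Main.v *)
(** Expanding h = f +- g by rows, the determinant becomes a sum over the choices,
    for each k, of one of the letters k and kbar on the main diagonal; the sign
    (-1)^(n-k) is the cost of moving the row of kbar below the rows of all larger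
    indices, so that the chosen letters are sorted. It remains to treat tableaux
    with a prescribed main diagonal, adding the letters one rank at a time. On
    determinants a letter multiplies every entry by 1 + w q (primed) or by
    1 / (1 - w q) (unprimed). By multilinearity, after a column operation in the
    unprimed case, this replaces the determinant at mu by a sum over nu of
    determinants at nu, where mu/nu runs over the vertical, respectively
    horizontal, strips, the other terms vanishing for having a zero column or two
    equal columns. On tableaux the same recursion removes the largest letter. *)

Require Import Defs.
From mathcomp Require Import all_boot all_order all_fingroup all_algebra.
From mathcomp Require Import zify.

Set Implicit Arguments.
Unset Strict Implicit.
Unset Printing Implicit Defensive.

Import GRing.Theory.

Local Open Scope ring_scope.

(** * Determinants of row generating functions *)

(** Multilinearity in the columns: [nu] picks one summand from each column. *)
Lemma det_sum_cols (R : comPzRingType) n (T : finType) (Q : 'I_n -> pred T)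
    (c : 'I_n -> T -> R) (f : 'I_n -> 'I_n -> T -> R) :
  \det (\matrix_(i, j) \sum_(v | Q j v) c j v * f i j v) =
  \sum_(nu in family Q) (\prod_j c j (nu j)) * \det (\matrix_(i, j) f i j (nu j)).
Proof.
rewrite -det_tr [LHS]/determinant.
transitivity (\sum_(s : 'S_n) \sum_(nu in family Q)
    (\prod_j c j (nu j)) * ((-1) ^+ s * \prod_j f (s j) j (nu j))).
  apply: eq_bigr => s _; under eq_bigr do rewrite !mxE.
  rewrite bigA_distr_big_dep mulr_sumr; apply: eq_bigr => nu _.
  by rewrite big_split /= mulrCA.
rewrite exchange_big /=; apply: eq_bigr => nu _.
rewrite -mulr_sumr -det_tr; congr (_ * _).
by apply: eq_bigr => s _; congr (_ * _); apply: eq_bigr => i _; rewrite !mxE.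
Qed.

Lemma det_eq_cols (R : comPzRingType) n (A : 'M[R]_n) j1 j2 :
  j1 != j2 -> (forall i, A i j1 = A i j2) -> \det A = 0.
Proof.
move=> j12 eqA; rewrite -det_tr; apply: (determinant_alternate j12) => i.
by rewrite !mxE.
Qed.

Lemma det_col0 (R : comPzRingType) n (A : 'M[R]_n) j :
  (forall i, A i j = 0) -> \det A = 0.
Proof.
by move=> A0; rewrite (expand_det_col A j) big1 // => i _; rewrite A0 mul0r.
Qed.

(** Expanding along row [j0], only the diagonal entry contributes, and its cofactor does not see
    column [j0]. *)
Lemma det_pivot_col (R : comPzRingType) n (A B : 'M[R]_n) j0 :
    (forall i j, j != j0 -> A i j = B i j) ->
    (forall j, A j0 j = B j0 j) -> (forall j, j != j0 -> A j0 j = 0) ->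
  \det A = \det B.
Proof.
move=> eqc eqr A0; rewrite !(expand_det_row _ j0); apply: eq_bigr => j _.
have [->|nj] := eqVneq j j0; last by rewrite -eqr A0 // !mul0r.
rewrite eqr /cofactor; do 2!congr (_ * _).
by congr determinant; apply/matrixP=> i k; rewrite !mxE eqc // eq_sym neq_lift.
Qed.

(** * Recursion on the rank for determinants *)

Section Alternants.
Variables (R : comNzRingType) (w : nat -> R).

(** Coefficients of the product of the series of [f] with 1/(1 - w_r q) for odd [r] (unprimed
    letter), with 1 + w_r q for even [r] (primed letter). *)
Definition letter_step r (f : nat -> R) m : R :=
  if odd r then \sum_(j < m.+1) w r ^+ (m - j) * f j
  else f m + (if m is m'.+1 then w r * f m' else 0).

(* Coefficients of the generating function, by length, of the rows which start
   on the main diagonal with the letter of rank a (its weight being omitted)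
   and continue with letters of ranks in [a, r). *)
Fixpoint row_gf (a r : nat) : nat -> R :=
  if r is r'.+1 then
    letter_step r' (fun m => row_gf a r' m + ((a == r') && (m == 1))%:R)
  else fun=> 0.

Lemma row_gf_rec a r : row_gf a r.+1 =
  letter_step r (fun m => row_gf a r m + ((a == r) && (m == 1))%:R).
Proof. by []. Qed.

#[global] Arguments row_gf : simpl never.

Lemma letter_step_eq0 r f : f =1 (fun=> 0) -> letter_step r f =1 (fun=> 0).
Proof.
move=> f0 m; rewrite /letter_step; case: ifP => _.
  by rewrite big1 // => j _; rewrite f0 mulr0.
by case: m => [|m]; rewrite !f0 ?mulr0 addr0.
Qed.

(** The step is a geometric sum, so subtracting the scaled sum up to [L] leaves only the lengths
    above [L]. *)
Lemma letter_step_odd_diff r f L m : odd r -> (L <= m)%N ->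
  letter_step r f m - w r ^+ (m - L) * letter_step r f L =
    \sum_(L.+1 <= v < m.+1) w r ^+ (m - v) * f v.
Proof.
move=> odd_r le_Lm; rewrite /letter_step odd_r mulr_sumr.
under [X in _ - X]eq_bigr => v _.
  have -> : w r ^+ (m - L) * (w r ^+ (L - v) * f v) = w r ^+ (m - v) * f v.
    by rewrite mulrA -exprD; congr (w r ^+ _ * _); have := ltn_ord v; lia.
  over.
rewrite -!(big_mkord xpredT (fun v => w r ^+ (m - v) * f v)).
by rewrite (big_cat_nat (n := L.+1) (p := m.+1)) //= addrAC subrr add0r.
Qed.

Lemma row_gf_small a r : (r <= a)%N -> row_gf a r =1 (fun=> 0).
Proof.
elim: r => [//|r IHr] le_ra; rewrite row_gf_rec; apply: letter_step_eq0 => m.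
by rewrite IHr ?(ltnW le_ra) // gtn_eqF //= addr0.
Qed.

Lemma row_gf0 a r : row_gf a r 0 = 0.
Proof.
elim: r => // r IHr; rewrite row_gf_rec /letter_step big_ord1 !IHr andbF.
by case: ifP; rewrite !addr0 ?mulr0.
Qed.

Lemma row_gfS a r : (a < r)%N -> row_gf a r.+1 =1 letter_step r (row_gf a r).
Proof.
move=> lt_ar m; rewrite row_gf_rec ltn_eqF // /letter_step.
case: ifP => _; first by apply: eq_bigr => j _; rewrite addr0.
by case: m => [|m]; rewrite !addr0.
Qed.

(** Such a row repeats its unprimed diagonal letter, the first weight being omitted. *)
Lemma row_gf_start a m : odd a ->
  row_gf a a.+1 m = if m is m'.+1 then w a ^+ m' else 0.
Proof.
move=> odd_a; rewrite row_gf_rec eqxx /letter_step odd_a.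
case: m => [|m]; first by rewrite big_ord1 row_gf_small ?addr0 ?mulr0.
rewrite !big_ord_recl big1 => [|j _]; last first.
  by rewrite row_gf_small ?addr0 ?mulr0.
by rewrite !row_gf_small // !(mulr0, add0r, addr0, mulr1) /= subSS subn0.
Qed.

Variables (n N : nat) (alpha : 'I_n -> nat).
Hypothesis alpha_odd : forall i, odd (alpha i).
Hypothesis alpha_mono : forall i j : 'I_n, (i < j)%N -> (alpha i < alpha j)%N.

Implicit Types (mu nu : {ffun 'I_n -> 'I_N}) (r : nat).

(* Shapes of the boxes carrying a letter of rank < r, when the main diagonal of
   the tableau carries the letters of ranks alpha 0, alpha 1, ... Rows that have
   not been started are empty. *)
Definition stage r mu : bool :=
  [forall i, (0 < mu i)%N == (alpha i < r)%N] &&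
  [forall i : 'I_n, forall j : 'I_n,
     (i < j)%N && (0 < mu j)%N ==> (mu j + (j - i) <= mu i)%N].

(** Horizontal strip for odd [r]: each box of [mu] in row [j] lies below a box of [nu] in row [i],
    the shift [j - i] being due to row [j] starting in column [j]. Vertical strip for even [r]. *)
Definition strip r nu mu : bool :=
  [forall i, (nu i <= mu i)%N] &&
  (if odd r then [forall i : 'I_n, forall j : 'I_n,
     (i < j)%N && (0 < mu j)%N ==> (mu j + (j - i) <= nu i)%N]
   else [forall i, (mu i <= (nu i).+1)%N]).

(* The rows which have not been started are those of the identity matrix, so
   that the size of the determinant does not depend on r. *)
Definition stage_mx r mu : 'M[R]_n :=
  \matrix_(i, j) if (alpha i < r)%N then row_gf (alpha i) r (mu j) else (i == j)%:R.

Lemma stageP r mu :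
  reflect ((forall i, (0 < mu i)%N = (alpha i < r)%N) /\
           (forall i j : 'I_n, (i < j)%N -> (0 < mu j)%N -> (mu j + (j - i) <= mu i)%N))
          (stage r mu).
Proof.
apply: (iffP andP) => -[h1 h2]; split.
- by move=> i; move/forallP/(_ i)/eqP: h1.
- by move=> i j ij j0; move/forallP/(_ i)/forallP/(_ j)/implyP: h2; apply; rewrite ij.
- by apply/forallP => i; rewrite h1.
- by apply/forallP => i; apply/forallP => j; apply/implyP => /andP[]; apply: h2.
Qed.

(** Strict decrease between neighbouring rows accumulates to [j - i]; the rows in between are
    nonempty, being longer than row [j]. *)
Lemma stage_adj r mu :
    (forall i, (0 < mu i)%N = (alpha i < r)%N) ->
    (forall i j : 'I_n, j = i.+1 :> nat -> (0 < mu j)%N -> (mu j < mu i)%N) ->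
  stage r mu.
Proof.
move=> mu0 adj; apply/stageP; split=> // i j lt_ij.
have [d def_j] : exists d, j = (i + d.+1)%N :> nat.
  by exists (j - i).-1; lia.
elim: d j def_j {lt_ij} => [|d IHd] j def_j j0.
  by have := adj i j; lia.
have lt_jn : ((i + d.+1)%N < n)%N by have := ltn_ord j; lia.
have lt_j' : (mu j < mu (Ordinal lt_jn))%N by apply: adj => //=; lia.
by have := IHd (Ordinal lt_jn) erefl; rewrite /=; lia.
Qed.

Lemma stage_mx_col0 r mu (j : 'I_n) : (alpha j < r)%N -> mu j = 0%N :> nat ->
  \det (stage_mx r mu) = 0.
Proof.
move=> lt_jr j0; apply: (@det_col0 _ _ _ j) => i; rewrite mxE j0 row_gf0.
by case: ifPn => // le_ri; case: (i =P j) => // eij; rewrite eij lt_jr in le_ri.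
Qed.

(** Each entry is f(m) + w f(m - 1), so expanding by columns lets each length stay or drop by one.
    The choices [nu] that are not stages give determinant 0. *)
Lemma det_stage_even r mu : ~~ odd r -> stage r.+1 mu ->
  \det (stage_mx r.+1 mu) =
    \sum_(nu | stage r nu && strip r nu mu)
      (\prod_j w r ^+ ((mu j).-1 - (nu j).-1)) * \det (stage_mx r nu).
Proof.
move=> even_r /stageP[mu0 mus].
(* No row starts at an even rank. *)
have ltS i : (alpha i < r.+1)%N = (alpha i < r)%N.
  by rewrite ltnS leq_eqVlt; case: eqP => // e; rewrite -e alpha_odd in even_r.
pose Q (j : 'I_n) (v : 'I_N) := (v <= mu j <= v.+1)%N.
(* The predecessors discount the diagonal box, whose weight is omitted. *)
pose c (j : 'I_n) (v : 'I_N) := w r ^+ ((mu j).-1 - v.-1).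
pose f (i j : 'I_n) (v : 'I_N) : R :=
  if (alpha i < r)%N then row_gf (alpha i) r v else (i == j)%:R.
have -> : stage_mx r.+1 mu = \matrix_(i, j) \sum_(v | Q j v) c j v * f i j v.
  apply/matrixP => i j; rewrite !mxE ltS.
  have Qm : Q j (mu j) by rewrite /Q leqnn leqnSn.
  rewrite (bigD1 (mu j)) //= /c subnn expr0 mul1r /f.
  have := mu0 j; rewrite ltS => mu0j.
  have [m0|m_gt0] := posnP (mu j).
    rewrite big1 => [|v /andP[]].
      by rewrite m0 !row_gf0 addr0.
    by rewrite /Q -val_eqE /= => ? ?; lia.
  have ltp : ((mu j).-1 < N)%N by have := ltn_ord (mu j); lia.
  rewrite (bigD1 (Ordinal ltp)) /=; last first.
    by rewrite /Q /= -val_eqE /=; apply/andP; split; lia.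
  rewrite big1 ?addr0; last first.
    move=> v /andP[/andP[]]; rewrite /Q -!val_eqE /= => ? ? ?; lia.
  case: ifPn => lt_ir; last first.
    case: eqP => [eij|]; last by rewrite mulr0 addr0.
    by move: lt_ir; rewrite eij -mu0j m_gt0.
  rewrite row_gfS // /letter_step (negbTE even_r).
  case: (nat_of_ord (mu j)) m_gt0 => [//|m _] /=.
  (* For [mu j = 1] the truncated exponent gives w^0 in place of w, but both multiply the vanishing
     coefficient of length 0. *)
  case: m => [|m]; first by rewrite row_gf0 !mulr0.
  by rewrite /= subSnn expr1.
rewrite det_sum_cols [RHS]big_mkcond [LHS]big_mkcond /=; apply: eq_bigr => nu _.
rewrite -/(stage_mx r nu) /c; case: ifP => [/familyP Qnu|nQ]; last first.
  case: ifP => // /andP[_ /andP[/forallP h1]]; rewrite (negbTE even_r) => /forallP h2.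
  suff: nu \in family Q by rewrite nQ.
  by apply/familyP => j; rewrite unfold_in h1 h2.
have {Qnu} Qnu j : (nu j <= mu j <= (nu j).+1)%N by exact: Qnu.
have st : strip r nu mu.
  by rewrite /strip (negbTE even_r); apply/andP; split; apply/forallP => j;
    case/andP: (Qnu j).
rewrite st andbT; case: ifPn => // nst; apply/eqP.
have -> : \det (stage_mx r nu) = 0; last by rewrite mulr0.
(* Unless [nu] is a stage, it has an emptied row, hence a zero column, or two equal neighbouring
   lengths, hence two equal columns. *)
case: (pickP (fun j => (alpha j < r)%N && (nu j == 0%N :> nat))) => [j /andP[lt_j /eqP]|n0].
  exact: stage_mx_col0.
case: (pickP (fun p : 'I_n * 'I_n => [&& p.2 == p.1.+1 :> nat, (0 < nu p.2)%N & nu p.1 == nu p.2 :> nat])).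
  move=> [i j] /and3P[/= /eqP eij j0 /eqP enu].
  apply: (@det_eq_cols _ _ _ i j); first by rewrite -val_eqE /=; lia.
  move=> k; rewrite !mxE enu; case: ifPn => // le_rk.
  suff [-> ->] : (k == i = false) /\ (k == j = false) by [].
  have := mu0 i; have := mu0 j; rewrite !ltS => m_j m_i.
  have := Qnu i; have := Qnu j.
  split; apply/eqP => ek; subst k; move: le_rk; rewrite -?m_i -?m_j; lia.
move=> noeq; case/negP: nst; apply: (@stage_adj r).
  by move=> i; have := mu0 i; rewrite ltS; have := n0 i; have := Qnu i; lia.
move=> i j eij j0; have := noeq (i, j); rewrite /= eij eqxx j0 /=.
have := mus i j; have := Qnu i; have := Qnu j; lia.
Qed.

(** Unlike at even ranks, a row may start here; in its column some entries differ from the desired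
    ones, but they do not affect the determinant. *)
Lemma det_stage_odd r mu : odd r -> stage r.+1 mu ->
  \det (stage_mx r.+1 mu) =
    \sum_(nu | stage r nu && strip r nu mu)
      (\prod_j w r ^+ ((mu j).-1 - (nu j).-1)) * \det (stage_mx r nu).
Proof.
move=> odd_r /stageP[mu0 mus].
(* The lengths allowed for [nu j]. Comparing with the next row of [mu] suffices, because [mu] is a
   stage. *)
pose Q (j : 'I_n) (v : 'I_N) :=
  [&& (v <= mu j)%N, (0 < v)%N == (alpha j < r)%N &
   [forall k : 'I_n, (k == j.+1 :> nat) && (0 < mu k)%N ==> (mu k < v)%N]].
pose c (j : 'I_n) (v : 'I_N) := w r ^+ ((mu j).-1 - v.-1).
pose f (i j : 'I_n) (v : 'I_N) : R :=
  if (alpha i < r)%N then row_gf (alpha i) r v else (i == j)%:R.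
(* Subtracting from column j the multiple w^(mu_j - mu_(j+1)) of column j + 1
   turns the sum over all lengths v <= mu_j into the sum over
   mu_(j+1) < v <= mu_j, which is the interlacing condition of a strip. *)
pose U : 'M[R]_n := \matrix_(i, j) ((i == j)%:R -
   (if (i == j.+1 :> nat) && (0 < mu i)%N then w r ^+ (mu j - mu i) else 0)).
have detU : \det U = 1.
  rewrite det_trig; last first.
    apply/is_trig_mxP => i j lt_ij; rewrite mxE -val_eqE ltn_eqF //.
    by rewrite ltn_eqF ?subrr // ltnS ltnW.
  by rewrite big1 // => i _; rewrite mxE eqxx ltn_eqF // subr0.
transitivity (\det (stage_mx r.+1 mu *m U)); first by rewrite det_mulmx detU mulr1.
have MU i j : (stage_mx r.+1 mu *m U) i j = stage_mx r.+1 mu i j -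
    (if [pick k : 'I_n | (k == j.+1 :> nat) && (0 < mu k)%N] is Some k then
       w r ^+ (mu j - mu k) * stage_mx r.+1 mu i k else 0).
  rewrite mxE; under eq_bigr do rewrite [U _ _]mxE mulrBr.
  rewrite sumrB; congr (_ - _).
    rewrite (bigD1 j) //= eqxx mulr1 big1 ?addr0 // => k /negbTE ->.
    by rewrite mulr0.
  case: pickP => [k /andP[/eqP ek k0]|nok].
    rewrite (bigD1 k) //= ek eqxx k0 /= mulrC big1 ?addr0 // => k' nk.
    by rewrite -ek val_eqE (negbTE nk) mulr0.
  by rewrite big1 // => k _; rewrite nok mulr0.
suff -> : \det (stage_mx r.+1 mu *m U) =
    \det (\matrix_(i, j) \sum_(v | Q j v) c j v * f i j v).
  (* Taken over all columns, the conditions [Q] say that [nu] is a stage forming a strip with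
     [mu]. *)
  rewrite det_sum_cols (eq_bigl (fun nu => stage r nu && strip r nu mu)) // => nu.
  apply/familyP/andP => [Qnu|[/stageP[nu0 nus] /andP[/forallP le_nu]]]; last first.
    rewrite odd_r => /forallP h j; rewrite unfold_in le_nu nu0 eqxx /=.
    apply/forallP => k; apply/implyP => /andP[/eqP ek k0].
    have /forallP/(_ k)/implyP := h j; rewrite ek k0 ltnSn => /(_ isT).
    by rewrite subSnn addn1.
  have {}Qnu j : Q j (nu j) by exact: Qnu.
  have nu_lt (j k : 'I_n) : k = j.+1 :> nat -> (0 < mu k)%N -> (mu k < nu j)%N.
    move=> ek k0; case/and3P: (Qnu j) => _ _ /forallP/(_ k)/implyP; apply.
    by rewrite ek eqxx k0.
  have nu0 i : (0 < nu i)%N = (alpha i < r)%N by case/and3P: (Qnu i) => _ /eqP.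
  have le_nu i : (nu i <= mu i)%N by case/and3P: (Qnu i).
  split.
    apply: stage_adj => // i j eij j0; have := nu_lt i j eij; have := le_nu j; lia.
  rewrite /strip odd_r; apply/andP; split; first by apply/forallP.
  apply/forallP => i; apply/forallP => j; apply/implyP => /andP[lt_ij j0].
  have lt_i'n : (i.+1 < n)%N by have := ltn_ord j; lia.
  pose i' := Ordinal lt_i'n.
  have i'0 : (0 < mu i')%N.
    have [eij|lt_i'j] : j = i' \/ (i' < j)%N.
      by case: (ltngtP j i') => [|_|/val_inj]; [rewrite /=; lia | right | left].
      by rewrite -eij.
    by have := mus i' j lt_i'j j0; lia.
  have := nu_lt i i' erefl i'0.
  have [->|ne_ji'] := eqVneq j i'; first by rewrite /= subSnn addn1.
  have lt_i'j : (i' < j)%N by move: ne_ji'; rewrite -val_eqE /=; lia.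
  by have := mus i' j lt_i'j j0; rewrite /=; lia.
have lt_a i : (alpha i < r.+1)%N = (alpha i < r)%N || (alpha i == r).
  by rewrite ltnS leq_eqVlt orbC.
(* The excluded entries are those of a row started before [r], in the column of a row starting at
   [r]. *)
have N_E i j : (~~ ((alpha i < r)%N && (alpha j == r))) ->
    (stage_mx r.+1 mu *m U) i j = \sum_(v | Q j v) c j v * f i j v.
  have [lt_j|le_rj] := ltnP (alpha j) r => hij; last first.
    (* Row [j] has not started before [r], so the next row is empty: column [j] is unchanged, and
       only [v = 0] is allowed. *)
    rewrite MU; case: pickP => [k /andP[/eqP ek]|_].
      by have := @alpha_mono j k; rewrite mu0 ek; lia.
    have N0 : (0 < N)%N by exact: leq_ltn_trans (ltn_ord (mu j)).
    have QE v : Q j v = (v == Ordinal N0).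
      rewrite /Q -val_eqE /= [(alpha j < r)%N]ltnNge le_rj /= eqbF_neg -leqNgt leqn0.
      have [->|_] := eqVneq (v : nat) 0%N; last by rewrite andbF.
      rewrite /=; apply/forallP => k; apply/implyP => /andP[/eqP ek].
      by have := @alpha_mono j k; rewrite mu0 ek; lia.
    rewrite (big_pred1 (Ordinal N0)) // /c /f mxE subr0 lt_a.
    have [mj|mj] : nat_of_ord (mu j) = 0%N \/ alpha j = r.
    - by have := mu0 j; lia.
    - rewrite mj expr0 mul1r !row_gf0 /=.
      case: ltngtP => //= ai; case: (i =P j) => // eij; subst j.
      by have := mu0 i; lia.
    have -> : (alpha i < r)%N = false by move: hij; rewrite mj eqxx andbT => /negbTE.
    rewrite subn0 /=; case: ifP => [/eqP ai|nai].
      have -> : i = j.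
        apply/val_inj; case: (ltngtP i j) => //.
          by move/alpha_mono; rewrite ai mj ltnn.
        by move/alpha_mono; rewrite ai mj ltnn.
      rewrite mj row_gf_start // eqxx mulr1; have := mu0 j; rewrite mj ltnSn.
      by case: (nat_of_ord (mu j)).
    by case: (i =P j) nai => [->|_]; rewrite ?mj ?eqxx ?mulr0.
  case: (ltngtP (alpha i) r) (lt_a i) => ai /=.
  - move=> Si; pose L := if [pick k : 'I_n | (k == j.+1 :> nat) && (0 < mu k)%N] is Some k
                 then nat_of_ord (mu k) else 0%N.
    have -> : (stage_mx r.+1 mu *m U) i j = letter_step r (row_gf (alpha i) r) (mu j) -
                  w r ^+ (mu j - L) * letter_step r (row_gf (alpha i) r) L.
      rewrite MU !mxE Si -!row_gfS // /L; case: pickP => [k _|_].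
        by rewrite mxE Si.
      by rewrite row_gf0 mulr0.
    have le_L : (L <= mu j)%N.
      rewrite /L; case: pickP => // k /andP[/eqP ek k0].
      by have := mus j k; rewrite k0 ek; lia.
    have QE v : Q j v = (L < v <= mu j)%N.
      rewrite /Q lt_j eqb_id andbC /L; case: pickP => [k /andP[/eqP ek k0]|nok].
        apply/idP/idP => /andP[].
          case/andP=> v0 /forallP/(_ k)/implyP; rewrite ek eqxx k0 => /(_ isT) -> -> //.
        move=> lt_v ->; rewrite andbT (leq_ltn_trans _ lt_v) //=.
        apply/forallP => k'; apply/implyP => /andP[/eqP ek' _].
        by have -> : k' = k by apply/val_inj; rewrite /= ek ek'.
      congr (_ && _); rewrite -[RHS]andbT; congr (_ && _).
      by apply/forallP => k; rewrite nok.
    rewrite letter_step_odd_diff // (big_nat_widen _ _ N) ?ltn_ord // big_geq_mkord.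
    apply: eq_big => v; first by rewrite QE /= ltnS andbC.
    rewrite /= ltnS => /andP[le_v lt_L]; rewrite /c /f ai; congr (w r ^+ _ * _); lia.
  - move=> Si; have nij : (i == j) = false.
      by apply/eqP => eij; move: ai lt_j; rewrite eij; lia.
    rewrite [RHS]big1 => [|v _]; last by rewrite /f ltnNge ltnW //= nij mulr0.
    rewrite MU !mxE Si nij; case: pickP => [k /andP[_ k0]|_]; last exact: subr0.
    rewrite mxE Si; case: (i =P k) => [eik|_]; last by rewrite mulr0 subrr.
    by move: k0; rewrite mu0 -eik Si.
  (* Row [i] starts at rank [r]: its entries are the powers w^(mu_j - 1), which the column operation
     cancels to the left of the diagonal. *)
  - move=> Si; have nij : (i == j) = false.
      by apply/eqP => eij; move: ai lt_j; rewrite eij; lia.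
    rewrite [RHS]big1 => [|v _]; last by rewrite /f ai ltnn nij mulr0.
    rewrite MU !mxE Si; have mj : (0 < mu j)%N by rewrite mu0 ltnS ltnW.
    have lt_ji : (j < i)%N.
      by rewrite ltnNge; apply/negP; rewrite leq_eqVlt => /orP[/eqP/val_inj eij|/alpha_mono];
        [rewrite eij eqxx in nij | rewrite ai; lia].
    have lt_j'n : (j.+1 < n)%N := leq_ltn_trans lt_ji (ltn_ord i).
    have k0 : (0 < mu (Ordinal lt_j'n))%N.
      rewrite mu0 ltnS; case: (ltngtP j.+1 i) => [lt_k| |ek]; last 2 first.
      - by lia.
      - by rewrite (_ : Ordinal lt_j'n = i) ?ai //; apply/val_inj.
      by have := @alpha_mono (Ordinal lt_j'n) i lt_k; lia.
    case: pickP => [k /andP[/eqP ek]|/(_ (Ordinal lt_j'n))]; last by rewrite /= eqxx k0.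
    have -> : k = Ordinal lt_j'n by apply/val_inj.
    move=> _; rewrite mxE Si -ai !(row_gf_start _ (alpha_odd i)).
    have := mus j (Ordinal lt_j'n) (ltnSn _) k0; rewrite /= subSnn addn1.
    case: (nat_of_ord (mu (Ordinal lt_j'n))) k0 => // p _.
    case: (nat_of_ord (mu j)) => // q lt_pq.
    by rewrite -exprD; apply/eqP; rewrite subr_eq0; apply/eqP; congr (_ ^+ _); lia.
case: (pickP (fun j => alpha j == r)) => [j0 /eqP aj0|no_r]; last first.
  by congr (\det _); apply/matrixP => i j; rewrite [RHS]mxE N_E // no_r andbF.
have ne_a j : j != j0 -> alpha j != r.
  rewrite -aj0 -val_eqE; case: ltngtP => // [/alpha_mono|/alpha_mono]; last by move/gtn_eqF->.
  by move/ltn_eqF->.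
(* Row j0 has just been started: it is supported on its diagonal entry, so the
   rest of column j0 does not matter. *)
apply: (@det_pivot_col _ _ _ _ j0) => [i j nj|j|j nj].
- by rewrite [RHS]mxE N_E // (negbTE (ne_a j nj)) andbF.
- by rewrite [RHS]mxE N_E // aj0 ltnn.
- rewrite N_E ?aj0 ?ltnn // big1 // => v _.
  by rewrite /f aj0 ltnn eq_sym (negbTE nj) mulr0.
Qed.
Lemma det_stage_step r mu : stage r.+1 mu ->
  \det (stage_mx r.+1 mu) =
    \sum_(nu | stage r nu && strip r nu mu)
      (\prod_j w r ^+ ((mu j).-1 - (nu j).-1)) * \det (stage_mx r nu).
Proof. by case: (boolP (odd r)); [apply: det_stage_odd|apply: det_stage_even]. Qed.

Lemma det_stage0 mu : \det (stage_mx 0 mu) = 1.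
Proof. by rewrite -(det1 _ n); congr (\det _); apply/matrixP => i j; rewrite !mxE. Qed.

End Alternants.

(** * Removing the largest letter of a tableau *)

Section Letters.
Variable n : nat.

(** Inverse of [symbol_rank] on the ranks up to [2 * n]; among these only [n] reaches the last
    branch. *)
Definition symbol_of s : symbol n :=
  if insub s is Some k then Unbar k
  else if insub (2 * n - s)%N is Some k then Bar k else Zero.

Definition letter_of r : letter n := (symbol_of r./2, ~~ odd r).

Lemma symbol_rank_max (s : symbol n) : (symbol_rank s < (2 * n).+1)%N.
Proof. by case: s => [k||k] /=; try have := ltn_ord k; lia. Qed.

Lemma symbol_rank_inj : injective (@symbol_rank n).
Proof.
move=> [k||k] [l||l] //= e; try by [have := ltn_ord k; lia | have := ltn_ord l; lia].
- by congr Unbar; apply/val_inj.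
- by have := ltn_ord k; have := ltn_ord l; lia.
- by have := ltn_ord k; have := ltn_ord l; lia.
- by congr Bar; apply/val_inj => /=; have := ltn_ord k; have := ltn_ord l; lia.
Qed.

Lemma symbol_ofK s : (s < (2 * n).+1)%N -> symbol_rank (symbol_of s) = s.
Proof.
rewrite /symbol_of ltnS => le_s; case: insubP => [k _ <-|]; first by [].
rewrite -leqNgt => le_ns; case: insubP => [k _|]; rewrite /=; first by move=> ->; lia.
by rewrite -leqNgt => ?; lia.
Qed.

Lemma letter_rank_inj : injective (@letter_rank n).
Proof.
move=> [s b] [t c]; rewrite /letter_rank /primed /= => e.
have eb : b = c by case: b c e => [] []; lia.
by rewrite eb in e *; congr (_, _); apply: symbol_rank_inj; lia.
Qed.

Lemma letter_rank_max (a : letter n) : (letter_rank a < 2 * (2 * n).+1)%N.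
Proof. by case: a => s b; rewrite /letter_rank /=; have := symbol_rank_max s; lia. Qed.

Lemma letter_ofK r : (r < 2 * (2 * n).+1)%N -> letter_rank (letter_of r) = r.
Proof.
move=> lt_r; rewrite /letter_rank /letter_of /primed /= symbol_ofK; last lia.
by rewrite negbK; lia.
Qed.

Lemma odd_letter_rank (a : letter n) : odd (letter_rank a) = ~~ primed a.
Proof. by rewrite /letter_rank oddD mul2n odd_double; case: primed. Qed.

End Letters.

Lemma ltn_addb_trans (e : bool) (s t r : nat) : (s < t + e -> t < r -> s < r)%N.
Proof. by case: e; lia. Qed.

(** * Recursion on the rank for tableaux *)

Section Peeling.
Variables (n N : nat) (lam : n.-tuple nat) (R : comNzRingType) (W : letter n -> R).
Variable alpha : 'I_n -> nat.
Hypothesis alpha_odd : forall i, odd (alpha i).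

Implicit Types (b c : box lam) (P : filling lam) (mu nu : {ffun 'I_n -> 'I_N}).

Definition inside mu b : bool := (tagged b < mu (tag b))%N.

Lemma insideE mu b i p : tag b = i -> tagged b = p :> nat ->
  inside mu b = (p < mu i)%N.
Proof. by rewrite /inside => <- ->. Qed.

Definition row_lt b c : bool := (tag b == tag c) && (tagged b < tagged c)%N.
Definition col_lt b c : bool :=
  (tag b < tag c)%N && (tag b + tagged b == tag c + tagged c)%N.

(* Unprimed letters have odd rank, so that equality is allowed in rows for
   unprimed letters and in columns for primed ones. *)
Definition compatible b c (s t : nat) : bool :=
  (row_lt b c ==> (s < t + odd s)%N) && (col_lt b c ==> (s < t + ~~ odd s)%N).

(** A fixed letter outside the shape leaves a partial tableau determined by its letters inside, so
    that each is counted once. *)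
Definition blank : letter n := (Zero, false).

(* Tableaux of shape mu in the letters of rank < r, with prescribed main
   diagonal, seen as fillings of lam which are blank outside mu. *)
Definition partial_tableau r mu P : bool :=
  [forall b, if inside mu b then
     (letter_rank (P b) < r)%N &&
       ((nat_of_ord (tagged b) == 0%N) ==> (letter_rank (P b) == alpha (tag b)))
   else P b == blank] &&
  [forall b, forall c, inside mu b && inside mu c ==>
     compatible b c (letter_rank (P b)) (letter_rank (P c))].

Lemma partial_tableauP r mu P :
  reflect [/\ forall b, inside mu b -> (letter_rank (P b) < r)%N,
              forall b, inside mu b -> tagged b = 0%N :> nat ->
                letter_rank (P b) = alpha (tag b),
              forall b, ~~ inside mu b -> P b = blank &
              forall b c, inside mu b -> inside mu c ->
                compatible b c (letter_rank (P b)) (letter_rank (P c))]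
          (partial_tableau r mu P).
Proof.
apply: (iffP andP) => [[/forallP h1 /forallP h2]|[h1 h2 h3 h4]]; split.
- by move=> b ib; have := h1 b; rewrite ib => /andP[].
- by move=> b ib b0; have := h1 b; rewrite ib b0 => /andP[_ /eqP].
- by move=> b /negbTE ib; have := h1 b; rewrite ib => /eqP.
- by move=> b c ib ic; have /forallP/(_ c)/implyP := h2 b; rewrite ib ic; apply.
- apply/forallP => b; case: ifPn => ib; last by rewrite h3.
  by rewrite h1 //=; apply/implyP => /eqP b0; rewrite h2.
- apply/forallP => b; apply/forallP => c; apply/implyP => /andP[ib ic].
  exact: h4.
Qed.

Definition mkbox (i : 'I_n) (p : nat) (lt_p : (p < tnth lam i)%N) : box lam :=
  Tagged (fun i => 'I_(tnth lam i)) (Ordinal lt_p).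

(** Row lengths of the part carrying ranks below [r]. The maximum is at most [mu i], so [insubd]
    does not fall back on its default. *)
Definition cut r mu P : {ffun 'I_n -> 'I_N} := [ffun i => insubd (mu i)
  (\max_(p < tnth lam i | inside mu (mkbox (ltn_ord p)) &&
          (letter_rank (P (mkbox (ltn_ord p))) < r)) p.+1)%N].

Lemma insubd_bound (T : nat) (u : 'I_T) (m : nat) : (m <= u)%N -> insubd u m = m :> nat.
Proof. by move=> le_mu; rewrite val_insubd (leq_ltn_trans le_mu (ltn_ord u)). Qed.

Lemma mkboxE b (h : (tagged b < tnth lam (tag b))%N) : mkbox h = b.
Proof. by case: b h => i p h; congr existT; apply/val_inj. Qed.

Lemma cutE r mu P i : cut r mu P i = (\max_(p < tnth lam i | inside mu (mkbox (ltn_ord p)) &&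
          (letter_rank (P (mkbox (ltn_ord p))) < r)) p.+1)%N :> nat.
Proof.
by rewrite ffunE insubd_bound //; apply/bigmax_leqP => p /andP[].
Qed.

Lemma cut_le r mu P i : (cut r mu P i <= mu i)%N.
Proof. by rewrite cutE; apply/bigmax_leqP => p /andP[]. Qed.

(** Ranks increase weakly along rows, so the boxes of rank below [r] form an initial segment of each
    row. *)
Lemma inside_cut r mu P b : partial_tableau r.+1 mu P ->
  inside (cut r mu P) b = inside mu b && (letter_rank (P b) < r)%N.
Proof.
case/partial_tableauP => _ _ _ cP; rewrite [LHS]/inside cutE; case: b => i p /=.
have eb (q : 'I_(tnth lam i)) : mkbox (ltn_ord q) = Tagged (fun i => 'I_(tnth lam i)) q.
  exact: (mkboxE (b := Tagged (fun i => 'I_(tnth lam i)) q)).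
apply/idP/idP => [|pP]; last first.
  by apply: (@leq_bigmax_cond _ _ (fun q : 'I_(tnth lam i) => q.+1) p); rewrite eb.
apply: contraLR => nP; rewrite -leqNgt; apply/bigmax_leqP => q; rewrite !eb => /andP[iq rq].
rewrite ltnNge; apply: contra nP; rewrite leq_eqVlt => /orP[/eqP/val_inj -> |lt_pq].
  by rewrite iq.
have ip : inside mu (Tagged (fun i => 'I_(tnth lam i)) p).
  by rewrite /inside /= in iq *; apply: ltn_trans iq.
rewrite ip /=; have /andP[] := cP _ _ ip iq.
rewrite /row_lt /= eqxx lt_pq => /ltn_addb_trans/(_ rq) lt_r _; exact: lt_r.
Qed.

Definition erase nu P : filling lam := [ffun b => if inside nu b then P b else blank].
Definition fill r nu mu P : filling lam :=
  [ffun b => if inside mu b && ~~ inside nu b then letter_of n r else P b].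

Lemma cut_uniq mu nu : (forall i, mu i <= tnth lam i)%N ->
  (forall i, nu i <= tnth lam i)%N -> (forall b, inside mu b = inside nu b) -> mu = nu.
Proof.
move=> le_mu le_nu e; apply/ffunP => i; apply/val_inj => /=.
case: (ltngtP (mu i) (nu i)) => // lt.
  by have := e (mkbox (leq_trans lt (le_nu i))); rewrite /inside /= ltnn lt.
by have := e (mkbox (leq_trans lt (le_mu i))); rewrite /inside /= ltnn lt.
Qed.

(** All removed boxes have rank [r], and [compatible] forbids two of them in a column for odd [r],
    in a row for even [r]. The diagonal box of row [i] is kept exactly if [alpha i < r]. *)
Lemma cut_stage r mu P : (forall i, mu i <= tnth lam i)%N -> stage alpha r.+1 mu ->
  partial_tableau r.+1 mu P -> stage alpha r (cut r mu P) && strip r (cut r mu P) mu.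
Proof.
move=> le_mu /stageP[mu0 mus] pP; have cutP := inside_cut _ pP.
have le_cut := cut_le r mu P.
case/partial_tableauP: pP => rP dP _ cP; set nu := cut r mu P in cutP le_cut *.
(* Row [i] starts in column [i], so its box above box [p] of row [j] has offset [p + (j - i)]. *)
have col (i j : 'I_n) (p : nat) (lt_ij : (i < j)%N) (lt_p : (p < mu j)%N) :
    exists b, exists c, [/\ inside mu b, inside mu c, col_lt b c,
      tag b = i /\ tagged b = (p + (j - i))%N :> nat & tag c = j /\ tagged c = p :> nat].
  have lt_b : (p + (j - i) < mu i)%N by have := mus i j lt_ij; lia.
  exists (mkbox (leq_trans lt_b (le_mu i))), (mkbox (leq_trans lt_p (le_mu j))).
  by split=> //; rewrite /col_lt /= lt_ij; lia.
apply/andP; split.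
  apply/stageP; split=> [i|i j lt_ij j0].
    have [m0|m_gt0] := posnP (mu i).
      by have := mu0 i; have := le_cut i; rewrite m0; lia.
    pose b := mkbox (leq_trans m_gt0 (le_mu i)).
    by have := cutP b; rewrite {1 2}/inside /= m_gt0 dP.
  have lt_p : ((nu j).-1 < mu j)%N by have := le_cut j; lia.
  have [b [c [ib ic bc [tb vb] [tc vc]]]] := col i j _ lt_ij lt_p.
  have : inside nu c by rewrite (insideE _ tc vc); lia.
  rewrite cutP ic /= => rc; have /andP[_] := cP _ _ ib ic; rewrite bc /= => rb.
  have : inside nu b by rewrite cutP ib /=; case: odd rb; lia.
  by rewrite (insideE _ tb vb); lia.
rewrite /strip; apply/andP; split; first exact/forallP.
case: ifPn => odd_r.
  apply/forallP => i; apply/forallP => j; apply/implyP => /andP[lt_ij j0].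
  have lt_p : ((mu j).-1 < mu j)%N by lia.
  have [b [c [ib ic bc [tb vb] [tc vc]]]] := col i j _ lt_ij lt_p.
  have /andP[_] := cP _ _ ib ic; rewrite bc /= => rb.
  have rc := rP _ ic; have rb' := rP _ ib.
  have : inside nu b.
    rewrite cutP ib /=; move: rb' rb; rewrite ltnS leq_eqVlt => /orP[/eqP->|//].
    by rewrite odd_r; lia.
  by rewrite (insideE _ tb vb); lia.
(* If row [i] lost two boxes, those at offsets [nu i] and [nu i + 1] would both carry the primed
   letter of rank [r]. *)
apply/forallP => i; rewrite leqNgt; apply/negP => lt_nu.
have lt_b : (nu i < mu i)%N by lia.
have ib : inside mu (mkbox (leq_trans lt_b (le_mu i))) by [].
have ic : inside mu (mkbox (leq_trans lt_nu (le_mu i))) by [].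
have /andP[+ _] := cP _ _ ib ic; rewrite /row_lt /= eqxx ltnSn /=.
have := cutP (mkbox (leq_trans lt_b (le_mu i))).
have := cutP (mkbox (leq_trans lt_nu (le_mu i))).
have := rP _ ib; have := rP _ ic; rewrite ib ic /inside /= ltnn.
have -> : ((nu i).+1 < nu i)%N = false by lia.
move: (letter_rank _) => s; move: (letter_rank _) => t le_s le_t hs ht.
have [-> ->] : s = r /\ t = r by lia.
by rewrite (negbTE odd_r) addn0 ltnn.
Qed.

Lemma fill_erase r mu P : (r < 2 * (2 * n).+1)%N -> partial_tableau r.+1 mu P ->
  fill r (cut r mu P) mu (erase (cut r mu P) P) = P.
Proof.
move=> lt_r pP; apply/ffunP => b; rewrite !ffunE (inside_cut _ pP).
case/partial_tableauP: pP => rP _ bP _.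
case ib: (inside mu b) => /=; last by rewrite bP ?ib.
have := rP b ib; case: (ltnP (letter_rank (P b)) r) => //= le_r lt_rS.
by apply: letter_rank_inj; rewrite letter_ofK //; lia.
Qed.

(** The left-hand side is the index condition that reindexing by [fill] and [erase] produces. No
    added box precedes an old one in a row or column, [nu] being a stage, and the strip condition
    makes the added boxes compatible with each other. *)
Lemma fill_partial_tableau r nu mu P : (r < 2 * (2 * n).+1)%N ->
    (forall i, mu i <= tnth lam i)%N -> stage alpha r.+1 mu -> stage alpha r nu ->
    strip r nu mu ->
  partial_tableau r.+1 mu (fill r nu mu P) && (cut r mu (fill r nu mu P) == nu) &&
    (erase nu (fill r nu mu P) == P) = partial_tableau r nu P.
Proof.
move=> lt_r le_mu /stageP[mu0 mus] /stageP[nu0 nus] /andP[/forallP le_nu st].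
have sub b : inside nu b -> inside mu b by move=> ib; apply: leq_trans ib (le_nu _).
have fin b : inside nu b -> fill r nu mu P b = P b by rewrite ffunE => ->; rewrite andbF.
have fout b : inside mu b -> ~~ inside nu b -> letter_rank (fill r nu mu P b) = r.
  by rewrite ffunE => -> -> /=; rewrite letter_ofK.
apply/idP/idP => [/andP[/andP[pP /eqP ecut] /eqP eP]|].
  have cutP b := inside_cut b pP; rewrite ecut in cutP.
  case/partial_tableauP: pP => rP dP bP cP; apply/partial_tableauP; split.
  - by move=> b ib; have := ib; rewrite cutP fin // => /andP[].
  - by move=> b ib b0; rewrite -fin // dP // sub.
  - by move=> b /negbTE ib; rewrite -eP ffunE ib.
  - by move=> b c ib ic; have := cP _ _ (sub _ ib) (sub _ ic); rewrite !fin.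
case/partial_tableauP => rP dP bP cP.
have pP : partial_tableau r.+1 mu (fill r nu mu P).
  apply/partial_tableauP; split.
  - move=> b ib; case: (boolP (inside nu b)) => nb; last by rewrite fout.
    by rewrite fin // ltnW // ltnS rP.
  - move=> b ib b0; case: (boolP (inside nu b)) => nb; first by rewrite fin // dP.
    rewrite fout //; have := mu0 (tag b); have := nu0 (tag b).
    by move: ib nb; rewrite /inside b0; lia.
  - move=> b nib; rewrite ffunE (negbTE nib) /= bP //.
    by apply: contra nib; exact: sub.
  - move=> b c ib ic; rewrite /compatible.
    case: (boolP (inside nu b)) => nb; case: (boolP (inside nu c)) => nc.
    + by rewrite !fin //; exact: cP.
    + rewrite fin // (fout c) //; have := rP _ nb => lt_b.
      by apply/andP; split; apply/implyP => _; lia.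
    + have -> : row_lt b c = false.
        by apply/andP => -[/eqP eb lt_bc]; move: nb nc; rewrite !(insideE _ (esym eb) erefl) /inside; lia.
      rewrite /=; apply/implyP => /andP[lt_bc /eqP ebc].
      by have := nus _ _ lt_bc; move: nb nc; rewrite /inside; lia.
    + rewrite !fout //; case: (boolP (odd r)) st => odd_r st /=.
        rewrite addn1 ltnSn implybT /=; apply/implyP => /andP[lt_bc /eqP ebc].
        have /forallP/(_ (tag c))/implyP := forallP st (tag b); rewrite lt_bc /=.
        by move: ic nb; rewrite /inside; lia.
      rewrite addn1 ltnSn implybT andbT; apply/implyP => /andP[/eqP eb lt_bc].
      have := forallP st (tag b).
      by move: ib nb ic nc; rewrite !(insideE _ (esym eb) erefl) /inside; lia.
rewrite pP /=; apply/andP; split; apply/eqP; last first.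
  apply/ffunP => b; rewrite [LHS]ffunE; case: ifPn => nb; first exact: fin.
  by rewrite bP.
apply: cut_uniq => [i|i|b].
- exact: leq_trans (cut_le _ _ _ _) (le_mu i).
- exact: leq_trans (le_nu i) (le_mu i).
rewrite inside_cut //; case: (boolP (inside nu b)) => nb.
  by rewrite sub // fin // rP.
by case ib: (inside mu b) => //=; rewrite fout ?ltnn.
Qed.

Lemma weight_fill r nu mu P : (forall i, mu i <= tnth lam i)%N -> strip r nu mu ->
  \prod_(b | inside mu b && (0 < tagged b)%N) W (fill r nu mu P b) =
  (\prod_j W (letter_of n r) ^+ ((mu j).-1 - (nu j).-1)) *
  \prod_(b | inside nu b && (0 < tagged b)%N) W (P b).
Proof.
move=> le_mu /andP[/forallP le_nu _].
have sub b : inside nu b -> inside mu b by move=> ib; apply: leq_trans ib (le_nu _).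
rewrite (bigID (inside nu)) /= mulrC; congr (_ * _); last first.
  apply: eq_big => b; last by case/andP=> _ nb; rewrite ffunE nb andbF.
  by case: (boolP (inside nu b)) => [/sub ->|_]; rewrite ?andbT ?andbF.
transitivity (\prod_(b | inside mu b && (0 < tagged b)%N && ~~ inside nu b) W (letter_of n r)).
  by apply: eq_bigr => b /andP[/andP[ib _] nb]; rewrite ffunE ib nb.
transitivity (\prod_j \prod_(p < tnth lam j | ((p < mu j) && (0 < p) && ~~ (p < nu j))%N) W (letter_of n r)).
  by rewrite sig_big_dep.
apply: eq_bigr => j _; rewrite prodr_const; congr (_ ^+ _).
rewrite -sum1_card.
(* The added boxes off the main diagonal have offsets from max(1, nu_j) to mu_j - 1. *)
have -> : ((mu j).-1 - (nu j).-1 = (mu j) - maxn 1 (nu j))%N by lia.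
rewrite -[RHS]muln1 -sum_nat_const_nat (big_nat_widen _ _ (tnth lam j)) // big_geq_mkord.
by apply: eq_bigl => p; rewrite unfold_in /=; lia.
Qed.

(** The main diagonal is fixed by [alpha]; its weight is left out, as in [row_gf]. *)
Definition partial_sum r mu : R := \sum_(P | partial_tableau r mu P)
  \prod_(b | inside mu b && (0 < tagged b)%N) W (P b).

Lemma partial_sum_step r mu : (r < 2 * (2 * n).+1)%N ->
    (forall i, mu i <= tnth lam i)%N -> stage alpha r.+1 mu ->
  partial_sum r.+1 mu = \sum_(nu | stage alpha r nu && strip r nu mu)
    (\prod_j W (letter_of n r) ^+ ((mu j).-1 - (nu j).-1)) * partial_sum r nu.
Proof.
move=> lt_r le_mu st_mu; rewrite /partial_sum.
(* Tableaux are grouped by the shape [nu] of their letters of rank below [r]; the letter of rank [r]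
   fills the rest. *)
rewrite (partition_big (cut r mu) (fun nu => stage alpha r nu && strip r nu mu)) /=.
  apply: eq_bigr => nu /andP[st_nu st].
  rewrite (reindex_onto (fill r nu mu) (erase nu)) /=; last first.
    by move=> P /andP[pP /eqP <-]; exact: fill_erase.
  rewrite mulr_sumr; apply: eq_big => P.
    exact: fill_partial_tableau.
  by move=> _; exact: weight_fill.
by move=> P pP; exact: cut_stage.
Qed.

Lemma partial_sum0 mu : stage alpha 0 mu -> partial_sum 0 mu = 1.
Proof.
case/stageP => mu0 _; have out b : inside mu b = false.
  by have := mu0 (tag b); rewrite /inside; lia.
rewrite /partial_sum (big_pred1 [ffun => blank]) => [|P].
  by rewrite big1 // => b; rewrite out.
apply/partial_tableauP/eqP => [[_ _ bP _]|->].
  by apply/ffunP => b; rewrite ffunE bP ?out.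
by split=> [b|b|b|b c]; rewrite ?out // ffunE.
Qed.

Hypothesis alpha_mono : forall i j : 'I_n, (i < j)%N -> (alpha i < alpha j)%N.

(** Both sides are 1 at rank 0 and satisfy the same recursion over strips. *)
Theorem partial_sum_det r mu : (r <= 2 * (2 * n).+1)%N ->
    (forall i, mu i <= tnth lam i)%N -> stage alpha r mu ->
  partial_sum r mu = \det (stage_mx (fun s => W (letter_of n s)) alpha r mu).
Proof.
elim: r mu => [|r IHr] mu le_r le_mu st_mu.
  by rewrite partial_sum0 // det_stage0.
rewrite partial_sum_step // det_stage_step //; apply: eq_bigr => nu /andP[st_nu st].
congr (_ * _); apply: IHr st_nu => [|i]; first exact: ltnW.
by have /andP[/forallP/(_ i) le_nu _] := st; exact: leq_trans le_nu _.
Qed.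

End Peeling.

(** * Power series in one variable *)

Section OneVariable.
Variables (n : nat) (R : comNzRingType).
Implicit Types (l : 'I_n) (m : 'X_{1..n}) (f : nat -> R) (g : fps n R).

(** The series with coefficients [f] in the single variable q_l: the test says that [m] is a power
    of q_l. *)
Definition in_var l f : fps n R :=
  FPS (fun m => if m == (U_(l) *+ m l)%MM then f (m l) else 0).

Lemma in_varD l f1 f2 : in_var l (fun p => f1 p + f2 p) = in_var l f1 + in_var l f2.
Proof. by apply/fpsP => m; rewrite fcoefD /=; case: ifP; rewrite ?addr0. Qed.

Lemma in_varZ l a f : in_var l (fun p => a * f p) = a *: in_var l f.
Proof. by apply/fpsP => m; rewrite fcoefZ /=; case: ifP; rewrite ?mulr0. Qed.

Lemma eq_in_var l f1 f2 : f1 =1 f2 -> in_var l f1 = in_var l f2.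
Proof. by move=> e; apply/fpsP => m /=; rewrite e. Qed.

Lemma in_var_delta1 l : in_var l (fun p => (p == 1)%:R) = fvar R l.
Proof.
apply/fpsP => m /=; case: (m =P U_(l)%MM) => [->|ne].
  by rewrite mnm1E eqxx mulm1n eqxx.
case: eqP => // e; case: eqP => // e1; case: ne.
by rewrite e e1 mulm1n.
Qed.

Lemma fcoef_fvarM l g m :
  fcoef (fvar R l * g) m = if m l is 0 then 0 else fcoef g (m - U_(l))%MM.
Proof.
rewrite (fcoef_mul_mpoly (p := 'X_l) (q := fps_trunc (mdeg m).+1 g)); first last.
- by move=> k le_k; rewrite mcoeff_fps_trunc.
- by move=> k _; rewrite mcoeffX eq_sym.
case ml: (m l) => [|p].
  rewrite mcoeffM big1 // => k /eqP def_m; rewrite mcoeffX.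
  case: eqP => [e|_]; last by rewrite mul0r.
  by have /mnmP/(_ l) := def_m; rewrite mnmDE -e ml mnm1E eqxx.
have le_l : (U_(l) <= m)%MM.
  by apply/mnm_lepP => i; rewrite mnm1E; case: eqP => // <-; rewrite ml.
rewrite -{1}(submK le_l) addmC mulrC mcoeffMX mcoeff_fps_trunc // ltnS.
by rewrite -{2}(submK le_l) mdegD leq_addr.
Qed.

Lemma in_var_shift l f :
  in_var l (fun p => if p is p'.+1 then f p' else 0) = fvar R l * in_var l f.
Proof.
apply/fpsP => m; rewrite fcoef_fvarM /=; case ml: (m l) => [|p]; first by case: ifP.
rewrite mnmBE mnm1E eqxx ml subSS subn0; congr (if _ then _ else _).
apply/eqP/eqP => /mnmP e; apply/mnmP => i; have := e i; rewrite mnmBE !mulmnE !mnm1E.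
  by case: eqP => _; lia.
by case: eqP => [<-|_]; rewrite ?ml; lia.
Qed.

Lemma mdeg_ge m l : (m l <= mdeg m)%N.
Proof. by rewrite mdegE (bigD1 l) //= leq_addr. Qed.

(** The factors involve distinct variables, so [m] arises only by taking the power [m l] from
    each. *)
Lemma fcoef_prod_in_var (f : 'I_n -> nat -> R) m :
  fcoef (\prod_l in_var l (f l)) m = \prod_l f l (m l).
Proof.
set d := mdeg m.
(* Truncating at the degree of [m] keeps the coefficient and makes every sum finite. *)
pose p l : {mpoly R[n]} := \sum_(j < d.+1) f l j *: 'X_[U_(l) *+ j].
have agree l k : (mdeg k <= d)%N -> (p l)@_k = fcoef (in_var l (f l)) k.
  move=> le_kd; rewrite raddf_sum /=; under eq_bigr do rewrite mcoeffZ mcoeffX.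
  have le_kl : (k l < d.+1)%N by rewrite ltnS (leq_trans (mdeg_ge _ _)).
  rewrite (bigD1 (Ordinal le_kl)) //= eq_sym big1 ?addr0 => [|j ne_j].
    by case: eqP; rewrite ?mulr1 ?mulr0.
  case: eqP => [e|_]; last by rewrite mulr0.
  case/eqP: ne_j; apply/val_inj; rewrite /= -e.
  by rewrite mulmnE mnm1E eqxx mul1n.
have : forall k, (mdeg k <= d)%N ->
    (\prod_l p l)@_k = fcoef (\prod_l in_var l (f l)) k.
  elim/big_ind2: _ => [k _|P F Q G eF eG k le_kd|l _]; first by rewrite mcoeff1.
    symmetry; apply: fcoef_mul_mpoly => k' le_k'; rewrite ?eF ?eG //;
      exact: leq_trans le_kd.
  exact: agree.
move=> <- //; rewrite bigA_distr_bigA raddf_sum /=.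
have le_ml l : (m l < d.+1)%N by rewrite ltnS mdeg_ge.
pose e0 : {ffun 'I_n -> 'I_d.+1} := [ffun l => Ordinal (le_ml l)].
rewrite (bigD1 e0) //= [X in _ + X]big1 ?addr0 => [|e ne_e].
  rewrite scaler_prod mprodXE mcoeffZ mcoeffX.
  under [X in (X == _)]eq_bigr do rewrite ffunE /=.
  by rewrite -multinomUE_id eqxx mulr1; apply: eq_bigr => l _; rewrite ffunE.
rewrite scaler_prod mprodXE mcoeffZ mcoeffX; case: eqP => [em|_]; last by rewrite mulr0.
case/eqP: ne_e; apply/ffunP => l; apply/val_inj; rewrite ffunE /= -em mnm_sumE.
rewrite (bigD1 l) //= big1 ?addn0 => [|i ne_i]; rewrite mulmnE mnm1E ?eqxx ?mul1n //.
by rewrite (negbTE ne_i).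
Qed.

(** Column [l] involves only q_l, so each term of the determinant is a product of series in distinct
    variables. *)
Lemma fcoef_det_in_var (H : 'I_n -> nat -> R) m :
  fcoef (\det (\matrix_(k, l) in_var l (H k))) m = \det (\matrix_(k, l) H k (m l)).
Proof.
rewrite /determinant fcoef_sum; apply: eq_bigr => s _.
under eq_bigr do rewrite mxE; under [in RHS]eq_bigr do rewrite mxE.
have -> (k : fps n R) : fcoef ((-1) ^+ s * k) m = (-1) ^+ s * fcoef k m.
  by rewrite !mulr_sign; case: ifP.
congr (_ * _).
(* Reindexing by columns gives one factor per variable. *)
rewrite (reindex_inj (@perm_inj _ s^-1)) [RHS](reindex_inj (@perm_inj _ s^-1)) /=.
under eq_bigr do rewrite permKV.
by rewrite fcoef_prod_in_var; apply: eq_bigr => l _; rewrite permKV.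
Qed.

End OneVariable.

Section RowSeries.
Variables (n : nat) (F : fieldType) (w : nat -> F) (l : 'I_n).
Local Notation q := (fvar F l).

Lemma in_var_step_even r f : ~~ odd r ->
  in_var l (letter_step w r f) = in_var l f * (1 + w r *: q).
Proof.
move=> /negbTE even_r; rewrite (@eq_in_var _ _ _ _ (fun p => f p +
    w r * (if p is p'.+1 then f p' else 0))).
  by rewrite in_varD in_varZ in_var_shift mulrDr mulr1 -scalerAr [q * _]mulrC.
by move=> [|p]; rewrite /letter_step even_r ?mulr0.
Qed.

Lemma in_var_step_odd r f : odd r ->
  in_var l (letter_step w r f) = in_var l f / (1 - w r *: q).
Proof.
move=> odd_r; rewrite -[LHS](mulrK (fps_unit1B (w r) l)); congr (_ / _).
rewrite mulrBr mulr1 -scalerAr [_ * q]mulrC -in_var_shift -in_varZ -[in RHS]/f.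
apply/eqP; rewrite subr_eq -in_varD; apply/eqP; apply: eq_in_var => -[|p].
  by rewrite /letter_step odd_r big_ord1 mulr0 addr0 mul1r.
rewrite /letter_step odd_r big_ord_recr /= subnn mul1r addrC; congr (_ + _).
rewrite mulr_sumr; apply: eq_bigr => j _; rewrite mulrA -exprS; congr (_ ^+ _ * _).
by have := ltn_ord j; lia.
Qed.

(** Symbol [t] has ranks [2 * t] (primed) and [2 * t + 1], so one induction step adds both factors.
    The symbol [s] gives no primed factor, since its primed letter precedes the diagonal letter. *)
Lemma in_var_row_gf s T : (s < T)%N -> in_var l (row_gf w (2 * s).+1 (2 * T)) =
  q / (1 - w (2 * s).+1 *: q) *
  \prod_(t < T | (s < t)%N) ((1 + w (2 * t)%N *: q) / (1 - w (2 * t).+1 *: q)).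
Proof.
elim: T => // T IHT; rewrite ltnS [(2 * T.+1)%N](_ : _ = (2 * T).+2)%N; last by lia.
rewrite big_mkcond big_ord_recr /= -big_mkcond /=.
have od : odd (2 * T).+1 by rewrite /= mul2n odd_double.
have ev : ~~ odd (2 * T) by rewrite mul2n odd_double.
rewrite leq_eqVlt => /orP[/eqP <-|lt_sT].
  rewrite ltnn mulr1 big1 ?mulr1 => [|t lt_st]; last by have := ltn_ord t; lia.
  rewrite row_gf_rec in_var_step_odd //; last by rewrite /= mul2n odd_double.
  congr (_ / _); rewrite -in_var_delta1; apply: eq_in_var => p.
  by rewrite row_gf_small // eqxx add0r.
rewrite lt_sT (eq_in_var _ (row_gfS _ _)); last lia.
rewrite in_var_step_odd // (eq_in_var _ (row_gfS _ _)); last lia.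
by rewrite in_var_step_even // IHT // !mulrA.
Qed.

End RowSeries.

Lemma prod_ranks (R : comPzRingType) n (G : nat -> R) :
  \prod_(t < (2 * n).+1) G t =
  \prod_(i < n) G i * G n * \prod_(i < n) G (2 * n - i)%N.
Proof.
rewrite -(big_mkord xpredT) (big_cat_nat (n := n)) //=; last by lia.
rewrite big_mkord -mulrA; congr (_ * _).
rewrite big_ltn; last lia; congr (_ * _).
rewrite -[n.+1]add0n big_addn big_mkord.
have -> : ((2 * n).+1 - n.+1 = n)%N by lia.
rewrite (reindex_inj rev_ord_inj) /=; apply: eq_bigr => i _; congr G.
by have := ltn_ord i; lia.
Qed.

(** * The entries of the determinant as row generating series *)

Section ProblemRows.
Variables (n : nat) (F : fieldType) (x y : 'I_n -> F) (z0 : F).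

Local Notation W := (offdiag_wgt x y z0).
Local Notation w := (fun r => W (letter_of n r)).

Definition row_coef (s : symbol n) (p : nat) : F :=
  diag_wgt x y z0 (s, false) * row_gf w (2 * symbol_rank s).+1 (2 * (2 * n).+1) p.

Lemma letter_of_even t : letter_of n (2 * t) = (symbol_of n t, true).
Proof. by rewrite /letter_of mul2n odd_double doubleK. Qed.

Lemma letter_of_odd t : letter_of n (2 * t).+1 = (symbol_of n t, false).
Proof. by rewrite /letter_of /= mul2n odd_double /= uphalf_double. Qed.

Lemma symbol_rankK (s : symbol n) : symbol_of n (symbol_rank s) = s.
Proof. by apply: symbol_rank_inj; rewrite symbol_ofK // symbol_rank_max. Qed.

Lemma in_var_row_coef (l : 'I_n) s : let q := fvar F l in
  in_var l (row_coef s) = diag_wgt x y z0 (s, false) *: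
    (q / (1 - W (s, false) *: q) *
    (\prod_(i < n | (symbol_rank s < i)%N) ((1 + y i *: q) / (1 - x i *: q)) *
     (if (symbol_rank s < n)%N then (1 + z0^-1 *: q) / (1 - z0 *: q) else 1) *
     \prod_(i < n | (symbol_rank s < 2 * n - i)%N)
        ((1 + (x i)^-1 *: q) / (1 - (y i)^-1 *: q)))).
Proof.
move=> q; rewrite in_varZ in_var_row_gf ?symbol_rank_max // letter_of_odd symbol_rankK.
pose G t : fps n F := (1 + W (symbol_of n t, true) *: q) / (1 - W (symbol_of n t, false) *: q).
congr (_ *: (_ * _)).
transitivity (\prod_(t < (2 * n).+1) if (symbol_rank s < t)%N then G t else 1).
  rewrite -big_mkcond; apply: eq_bigr => t _.
  by rewrite /G -letter_of_even -letter_of_odd.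
rewrite (prod_ranks n (fun t => if (symbol_rank s < t)%N then G t else 1)) -!big_mkcond.
congr (_ * _ * _).
- by apply: eq_bigr => i _; rewrite /G (symbol_rankK (Unbar i)).
- by rewrite /G (symbol_rankK Zero).
- by apply: eq_bigr => i _; rewrite /G (symbol_rankK (Bar i)).
Qed.

(** After [k] come the larger unbarred symbols, 0 and every barred symbol: these give the last three
    factors of [f_]. *)
Lemma f_E k l : f_ x y z0 k l = in_var l (row_coef (Unbar k)).
Proof.
rewrite in_var_row_coef /f_ /= ltn_ord /diag_wgt /= !scalerAl !mulrA.
congr (_ * _); apply: eq_bigl => i.
by have := ltn_ord i; have := ltn_ord k; lia.
Qed.

Lemma g_E k l : g_ x y k l = in_var l (row_coef (Bar k)).
Proof.
rewrite in_var_row_coef /g_ /diag_wgt /= scale1r ifF; last by have := ltn_ord k; lia.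
rewrite [X in _ * (X * 1 * _)]big_pred0 => [|i]; last by have := ltn_ord i; have := ltn_ord k; lia.
rewrite !mul1r; congr (_ * _); apply: eq_bigl => i.
by have := ltn_ord i; have := ltn_ord k; lia.
Qed.

Lemma h_E k l : h_ x y z0 k l =
  in_var l (fun p => row_coef (Unbar k) p + (-1) ^+ (n - k.+1) * row_coef (Bar k) p).
Proof.
rewrite in_varD /h_ f_E g_E; congr (_ + _).
by rewrite [RHS]in_varZ -[in LHS]signr_odd -[in RHS]signr_odd mulr_sign scaler_sign.
Qed.

End ProblemRows.

(** * Choosing the main diagonal *)

Section RowOrder.
Variables (n : nat) (R : comNzRingType) (rho : symbol n -> nat -> R) (v : 'I_n -> nat).
Implicit Types (s : seq (symbol n)) (eps : 'I_n -> bool) (ks : seq 'I_n).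

(** Indexing rows by a sequence turns row exchanges into list manipulations. The sequences used have
    size [n], so the default [Zero] is not reached. *)
Definition rows_det s : R := \det (\matrix_(i < n, j < n) rho (nth Zero s i) (v j)).

Lemma rows_det_swap s1 a b s2 : size (s1 ++ [:: a, b & s2]) = n ->
  rows_det (s1 ++ [:: a, b & s2]) = - rows_det (s1 ++ [:: b, a & s2]).
Proof.
rewrite size_cat /= => sz.
have lt_i : (size s1 < n)%N by lia.
have lt_j : ((size s1).+1 < n)%N by lia.
rewrite /rows_det; set A := \matrix_(_, _) _; set B := \matrix_(_, _) _.
have -> : A = xrow (Ordinal lt_i) (Ordinal lt_j) B.
  apply/matrixP => k l; rewrite !mxE; congr (rho _ _).
  case: tpermP => [->|->|/eqP ni /eqP nj] /=; rewrite !nth_cat ?ltnn ?subnn ?subSnn //.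
  - by rewrite ltnNge leqnSn.
  - by rewrite ltnNge leqnSn.
  case: ltnP => // le_k; move: ni nj; rewrite -!val_eqE /=.
  case def_m: (k - size s1)%N => [|[|m]] //; lia.
by rewrite xrowE det_mulmx det_perm odd_tperm -val_eqE /= ltn_eqF // expr1 mulN1r.
Qed.

Lemma rows_det_move s1 a s2 s3 : size (s1 ++ a :: s2 ++ s3) = n ->
  rows_det (s1 ++ a :: s2 ++ s3) = (-1) ^+ size s2 * rows_det (s1 ++ s2 ++ a :: s3).
Proof.
elim: s2 s1 => [|b s2 IHs] s1 sz; first by rewrite mul1r.
rewrite rows_det_swap // -cat_rcons IHs ?cat_rcons; first by rewrite exprS mulN1r mulNr.
by move: sz; rewrite !size_cat.
Qed.

Definition choose_symbol eps k : symbol n := if eps k then Bar k else Unbar k.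

(** Increasing order of the chosen symbols: barred ones decrease as the index grows, whence the
    reversal. *)
Definition diag_symbols eps ks : seq (symbol n) :=
  [seq Unbar k | k <- ks & ~~ eps k] ++ rev [seq Bar k | k <- ks & eps k].

(* Moving the row of a barred letter k below the rows of all indices larger
   than k costs the sign (-1)^(n-k). *)
Lemma rows_det_arrange eps ks s1 s2 i :
    size (s1 ++ map (choose_symbol eps) ks ++ s2) = n -> drop i (enum 'I_n) = ks ->
  (\prod_(k <- ks | eps k) (-1) ^+ (n - k.+1)) *
    rows_det (s1 ++ map (choose_symbol eps) ks ++ s2) =
  rows_det (s1 ++ diag_symbols eps ks ++ s2).
Proof.
elim: ks i s1 s2 => [|k ks IHks] i s1 s2 sz def_ks; first by rewrite big_nil mul1r.
have def_ks' : drop i.+1 (enum 'I_n) = ks by rewrite -add1n -drop_drop def_ks /= drop0.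
(* Being a tail of the enumeration, [ks] lists exactly the indices above [k]. *)
have sz_ks : size ks = (n - k.+1)%N.
  have := congr1 size def_ks; rewrite size_drop size_enum_ord /= => szd.
  have lt_in : (i < n)%N by lia.
  have := nth_enum_ord k lt_in; rewrite -[i in nth _ _ i]addn0 -nth_drop def_ks /=; lia.
rewrite big_cons /diag_symbols /= {1}/choose_symbol; case: ifPn => ek /=.
  rewrite rev_cons -catA cat_rcons rows_det_move; last first.
    by move: sz; rewrite /= {1}/choose_symbol ek.
  rewrite size_map sz_ks mulrACA -exprD addnn -mul2n exprM sqrrN !expr1n mul1r.
  by rewrite (IHks i.+1) // -?catA //; move: sz; rewrite !size_cat /= ?size_cat /=; lia.
rewrite -cat_rcons (IHks i.+1) ?cat_rcons //.
by move: sz; rewrite !size_cat /= ?size_cat; lia.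
Qed.

(** Multilinearity in the rows, by transposition; the signs of the barred rows are absorbed by
    sorting. *)
Lemma det_two_rows :
  \det (\matrix_(k < n, l < n)
          (rho (Unbar k) (v l) + (-1) ^+ (n - k.+1) * rho (Bar k) (v l))) =
  \sum_(eps : {ffun 'I_n -> bool}) rows_det (diag_symbols eps (enum 'I_n)).
Proof.
rewrite -det_tr; pose c (k : 'I_n) (b : bool) : R := if b then (-1) ^+ (n - k.+1) else 1.
pose f (l k : 'I_n) (b : bool) := rho (if b then Bar k else Unbar k) (v l).
have -> : (\matrix_(k < n, l < n)
     (rho (Unbar k) (v l) + (-1) ^+ (n - k.+1) * rho (Bar k) (v l)))^T =
    \matrix_(l, k) \sum_(b | xpredT b) c k b * f l k b.
  by apply/matrixP => l k; rewrite !mxE big_bool /= /c mul1r addrC.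
rewrite det_sum_cols; apply: eq_big => [eps|eps _]; first exact/familyP.
rewrite -[diag_symbols _ _]cats0 -[_ ++ [::]]cat0s -(@rows_det_arrange _ _ _ _ 0) ?drop0 //; last first.
  by rewrite /= cats0 size_map size_enum_ord.
rewrite big_enum_cond /= cats0; congr (_ * _); first by rewrite [RHS]big_mkcond.
rewrite /rows_det -det_tr; congr (\det _); apply/matrixP => l k; rewrite !mxE.
by rewrite (nth_map l) ?size_enum_ord // nth_ord_enum.
Qed.

End RowOrder.

Section DiagonalSymbols.
Variable n : nat.
Implicit Types (eps : 'I_n -> bool) (s t : symbol n).

Definition symbol_lt s t : bool := (symbol_rank s < symbol_rank t)%N.

Local Notation diag eps := (diag_symbols eps (enum 'I_n)).

Lemma mem_diag_symbols eps s : (s \in diag eps) =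
  match s with Unbar k => ~~ eps k | Zero => false | Bar k => eps k end.
Proof.
have inj1 : injective (@Unbar n) by move=> ? ? [].
have inj2 : injective (@Bar n) by move=> ? ? [].
rewrite mem_cat mem_rev; case: s => [k||k].
- rewrite (mem_map inj1) mem_filter mem_enum andbT orbC.
  by case: mapP => // -[].
- by apply/negbTE/norP; split; apply/mapP => -[].
- rewrite (mem_map inj2) mem_filter mem_enum andbT.
  by case: mapP => // -[].
Qed.

Lemma size_diag_symbols eps : size (diag eps) = n.
Proof.
rewrite size_cat size_rev !size_map !size_filter addnC.
exact: etrans (count_predC eps _) (size_enum_ord n).
Qed.

Lemma sorted_diag_symbols eps : sorted symbol_lt (diag eps).
Proof.
have tr : transitive symbol_lt by move=> s t u; exact: ltn_trans.
have so : sorted (fun k l : 'I_n => (k < l)%N) (enum 'I_n).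
  by have := iota_ltn_sorted 0 n; rewrite -val_enum_ord sorted_map.
have tr' : transitive (fun k l : 'I_n => (k < l)%N) by move=> ? ? ?; exact: ltn_trans.
rewrite sorted_pairwise // pairwise_cat -!sorted_pairwise // rev_sorted !sorted_map.
apply/and3P; split.
- apply/allrelP => s t; rewrite mem_rev => /mapP[k _ ->] /mapP[l _ ->].
  by rewrite /symbol_lt /=; have := ltn_ord k; have := ltn_ord l; lia.
- exact: sorted_filter.
- apply: (sub_sorted (e := fun k l : 'I_n => (k < l)%N)); last exact: sorted_filter.
  by move=> k l; rewrite /symbol_lt /=; have := ltn_ord l; lia.
Qed.

End DiagonalSymbols.

(** * Tableaux grouped by their main diagonal *)

Section Grouping.
Variables (n : nat) (lam : n.-tuple nat).
Hypothesis lam_strict : strict_partition lam.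

Local Notation diag eps := (diag_symbols eps (enum 'I_n)).
Local Notation max_rank := (2 * (2 * n).+1)%N.

Implicit Types (P : filling lam) (eps : {ffun 'I_n -> bool}) (b c : box lam).

Lemma part_gt0 i : (0 < tnth lam i)%N.
Proof. by have /andP[_ /all_tnthP] := lam_strict; apply. Qed.

Lemma part_lt (i j : 'I_n) : (i < j)%N -> (tnth lam j < tnth lam i)%N.
Proof.
have /andP[so _] := lam_strict => lt_ij; rewrite !(tnth_nth 0%N).
have tr : transitive gtn by move=> a b c /= ? h; apply: ltn_trans h _.
by apply: (sorted_ltn_nth tr 0%N so) => //; rewrite inE size_tuple.
Qed.

Definition part_bound := (\max_i tnth lam i).+1.

Lemma part_lt_bound i : (tnth lam i < part_bound)%N.
Proof. by rewrite ltnS (leq_bigmax i). Qed.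

Definition full_shape : {ffun 'I_n -> 'I_part_bound} := [ffun i => Ordinal (part_lt_bound i)].

Lemma inside_full b : inside full_shape b.
Proof. by rewrite /inside ffunE /=. Qed.

Lemma stage_full (alpha : 'I_n -> nat) r : (forall i, alpha i < r)%N ->
  stage alpha r full_shape.
Proof.
move=> lt_a; apply: stage_adj => [i|i j eij _]; first by rewrite ffunE /= part_gt0 lt_a.
by rewrite !ffunE /= part_lt // eij.
Qed.

(** The main diagonal increases strictly, so the set of letters chosen by [eps] determines the
    letter of each row. *)
Definition diag_rank eps (i : 'I_n) := (2 * symbol_rank (nth Zero (diag eps) i)).+1.

Lemma diag_rank_odd eps i : odd (diag_rank eps i).
Proof. by rewrite /= mul2n odd_double. Qed.

Lemma diag_rank_mono eps (i j : 'I_n) :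
  (i < j)%N -> (diag_rank eps i < diag_rank eps j)%N.
Proof.
move=> lt_ij; rewrite ltnS ltn_mul2l /=.
have tr : transitive (@symbol_lt n) by move=> s t u; exact: ltn_trans.
by apply: (sorted_ltn_nth tr Zero (sorted_diag_symbols eps)) => //;
  rewrite inE size_diag_symbols.
Qed.

Lemma diag_rank_max eps i : (diag_rank eps i < max_rank)%N.
Proof. by have := symbol_rank_max (nth Zero (diag eps) i); rewrite /diag_rank; lia. Qed.

Lemma letter_rank_unprimed (s : symbol n) : letter_rank (s, false) = (2 * symbol_rank s).+1.
Proof. by rewrite /letter_rank /= addn1. Qed.

Definition diag_box i : box lam := mkbox (part_gt0 i).

Lemma box_eq b i p (h : (p < tnth lam i)%N) :
  tag b = i -> tagged b = p :> nat -> b = mkbox h.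
Proof.
by case: b => j q /= eji; case: i / eji h => h eqp; congr existT; apply/val_inj.
Qed.

Lemma row_ltE b c : row_lt b c = (box_row b == box_row c) && (box_col b < box_col c)%N.
Proof. by rewrite /row_lt -val_eqE /box_row /box_col /=; lia. Qed.

Lemma col_ltE b c : col_lt b c = (box_row b < box_row c)%N && (box_col b == box_col c).
Proof. by []. Qed.

Lemma box_inj b c : box_row b = box_row c -> box_col b = box_col c -> b = c.
Proof.
move=> er ec; rewrite -(mkboxE (ltn_ord (tagged c))).
by apply: box_eq; [exact/val_inj | move: er ec; rewrite /box_row /box_col; lia].
Qed.

Lemma on_diagE b : on_diag b = (nat_of_ord (tagged b) == 0%N).
Proof. by rewrite /on_diag /box_row /box_col; lia. Qed.

Lemma on_diag_box b : on_diag b -> b = diag_box (tag b).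
Proof. by rewrite on_diagE => /eqP; apply: box_eq. Qed.

Lemma appears_on_diagP P a :
  reflect (exists i, P (diag_box i) = a) (appears_on_diag P a).
Proof.
apply: (iffP existsP) => [[b /andP[/on_diag_box -> /eqP]]|[i def_a]].
  by exists (tag b).
by exists (diag_box i); rewrite on_diagE def_a !eqxx.
Qed.

Definition barred P : {ffun 'I_n -> bool} :=
  [ffun k => appears_on_diag P (Bar k, false)].

Lemma partial_full_tableau eps P :
  partial_tableau (diag_rank eps) max_rank full_shape P -> tableau P && (barred P == eps).
Proof.
case/partial_tableauP => _ dP _ cP.
have {}cP b c : compatible b c (letter_rank (P b)) (letter_rank (P c)).
  by apply: cP; exact: inside_full.
have {}dP i : P (diag_box i) = (nth Zero (diag eps) i, false).
  by apply: letter_rank_inj; rewrite letter_rank_unprimed dP ?inside_full.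
have rowP b c : box_row b = box_row c -> (box_col b < box_col c)%N ->
    (letter_rank (P b) < letter_rank (P c) + ~~ primed (P b))%N.
  move=> er lt_col; have /andP[+ _] := cP b c.
  by rewrite odd_letter_rank => /implyP; apply; rewrite row_ltE er eqxx.
have colP b c : box_col b = box_col c -> (box_row b < box_row c)%N ->
    (letter_rank (P b) < letter_rank (P c) + primed (P b))%N.
  move=> ecol lt_row; have /andP[_] := cP b c.
  by rewrite odd_letter_rank negbK => /implyP; apply; rewrite col_ltE lt_row ecol eqxx.
have appE s : appears_on_diag P (s, false) = (s \in diag eps).
  apply/appears_on_diagP/idP => [[i]|].
    by rewrite dP => -[<-]; rewrite mem_nth // size_diag_symbols.
  case/(nthP Zero) => i; rewrite size_diag_symbols => lt_i <-.
  by exists (Ordinal lt_i); rewrite dP.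
apply/andP; split; last by apply/eqP/ffunP => k; rewrite ffunE appE mem_diag_symbols.
apply/and5P; split; last (apply/and3P; split).
- apply/forallP => b; apply/forallP => c; apply/implyP => /andP[/eqP er].
  rewrite leq_eqVlt => /orP[/eqP ec|lt_c]; first by rewrite (box_inj er ec) /letter_le.
  by have := rowP _ _ er lt_c; rewrite /letter_le; case: primed; lia.
- apply/forallP => b; apply/forallP => c; apply/implyP => /andP[/eqP ec].
  rewrite leq_eqVlt => /orP[/eqP er|lt_r]; first by rewrite (box_inj er ec) /letter_le.
  by have := colP _ _ ec lt_r; rewrite /letter_le; case: primed; lia.
- apply/forallP => b; apply/forallP => c; apply/implyP => /andP[/eqP er /eqP ec].
  (* The box [d] right of [b] and above [c] exists because [lam] is strict. Equal letters in [b] and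
     [d] would be unprimed, in [d] and [c] primed, so not both steps are equalities. *)
  have lt_d : ((tagged b).+1 < tnth lam (tag b))%N.
    have := @part_lt (tag b) (tag c); have := ltn_ord (tagged c).
    by move: er ec; rewrite /box_row /box_col; lia.
  pose d := mkbox lt_d.
  have := rowP b d erefl; rewrite /box_col /= ltn_add2l ltnSn => /(_ isT).
  have := colP d c; rewrite /= -/(box_row b) er ltnSn => /(_ _ isT).
  have -> : box_col d = box_col c by rewrite ec /box_col /= addnS.
  move=> /(_ erefl); rewrite /letter_lt.
  have := odd_letter_rank (P b); have := odd_letter_rank (P d).
  by case: (primed (P b)); case: (primed (P d)) => /=; lia.
- apply/forallP => b; apply/forallP => c; apply/implyP => /and3P[/eqP er ne_bc pb].
  apply/eqP => ebc; case: (ltngtP (box_col b) (box_col c)) => [lt|lt|ec].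
  + by have := rowP _ _ er lt; rewrite -ebc pb addn0 ltnn.
  + by have := rowP _ _ (esym er) lt; rewrite -ebc pb addn0 ltnn.
  + by case/eqP: ne_bc; exact: box_inj.
- apply/forallP => b; apply/forallP => c; apply/implyP => /and3P[/eqP ec ne_bc pb].
  apply/eqP => ebc; case: (ltngtP (box_row b) (box_row c)) => [lt|lt|er].
  + by have := colP _ _ ec lt; rewrite -ebc (negbTE pb) addn0 ltnn.
  + by have := colP _ _ (esym ec) lt; rewrite -ebc (negbTE pb) addn0 ltnn.
  + by case/eqP: ne_bc; exact: box_inj.
- by apply/forallP => b; apply/implyP => /on_diag_box ->; rewrite dP.
- apply/forallP => k; rewrite !appE !mem_diag_symbols.
  by case: (eps k).
Qed.

Lemma tableau_partial_full eps P :
  tableau P -> barred P = eps -> partial_tableau (diag_rank eps) max_rank full_shape P.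
Proof.
case/and5P => /forallP rw /forallP cw /forallP ds /forallP rp /and3P[/forallP cu /forallP du /forallP one] eE.
have unp i : P (diag_box i) = ((P (diag_box i)).1, false).
  have /implyP := du (diag_box i); rewrite on_diagE /= => /(_ isT).
  by rewrite /primed; case: (P _) => s [].
pose dsym := [seq (P (diag_box i)).1 | i <- enum 'I_n].
have sz : size dsym = n by rewrite size_map size_enum_ord.
have nth_dsym (i : 'I_n) : nth Zero dsym i = (P (diag_box i)).1.
  by rewrite (nth_map i) ?size_enum_ord // nth_ord_enum.
have sub : {subset diag eps <= dsym}.
  have app s : appears_on_diag P (s, false) -> s \in dsym.
    by case/appears_on_diagP => i def_s; apply/mapP; exists i; rewrite ?mem_enum ?def_s.
  move=> s; rewrite mem_diag_symbols; case: s => [k nek||k ek] //; apply: app.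
    by have := one k; move: nek; rewrite -eE ffunE => /negbTE ->; rewrite addbF.
  by move: ek; rewrite -eE ffunE.
have ir : irreflexive (@symbol_lt n) by move=> s; exact: ltnn.
have tr : transitive (@symbol_lt n) by move=> s t u; exact: ltn_trans.
have so : sorted (@symbol_lt n) dsym.
  apply/(sortedP Zero) => i; rewrite sz => lt_i1.
  pose i' : 'I_n := Ordinal (ltn_trans (ltnSn i) lt_i1); pose j' := Ordinal lt_i1.
  rewrite (nth_dsym i') (nth_dsym j').
  have /forallP/(_ (diag_box j'))/implyP := ds (diag_box i').
  rewrite /box_row /box_col /= !addn0 eqxx => /(_ isT).
  by rewrite /letter_lt unp [P (diag_box j')]unp !letter_rank_unprimed /symbol_lt /=; lia.
(* The diagonal contains every chosen symbol and has as many entries; strictly sorted sequences with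
   the same elements coincide. *)
have eq_d : diag eps = dsym.
  apply: (irr_sorted_eq tr ir) => //; first exact: sorted_diag_symbols.
  have [] // := @uniq_min_size _ (diag eps) dsym.
    exact: (sorted_uniq tr ir (sorted_diag_symbols eps)).
  by rewrite sz size_diag_symbols.
apply/partial_tableauP; split.
- by move=> b _; exact: letter_rank_max.
- move=> b _ b0; have db : on_diag b by rewrite on_diagE b0.
  by rewrite (on_diag_box db) unp letter_rank_unprimed /diag_rank eq_d nth_dsym.
- by move=> b; rewrite inside_full.
move=> b c _ _; rewrite /compatible odd_letter_rank negbK; apply/andP; split; apply/implyP.
  rewrite row_ltE => /andP[/eqP er lt_c].
  have ne : b != c by apply: contraTneq lt_c => ->; rewrite ltnn.
  have /forallP/(_ c)/implyP := rw b; rewrite er eqxx ltnW // => /(_ isT).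
  have /forallP/(_ c)/implyP := rp b; rewrite er eqxx ne /=.
  rewrite /letter_le; case: (primed (P b)) => [/(_ isT) neP|_]; last by lia.
  by rewrite addn0 ltn_neqAle => ->; rewrite andbT (inj_eq (@letter_rank_inj n)).
rewrite col_ltE => /andP[lt_r /eqP ec].
have ne : b != c by apply: contraTneq lt_r => ->; rewrite ltnn.
have /forallP/(_ c)/implyP := cw b; rewrite ec eqxx ltnW // => /(_ isT).
have /forallP/(_ c)/implyP := cu b; rewrite ec eqxx ne /=.
rewrite /letter_le; case: (primed (P b)) => [_|/(_ isT) neP]; first by lia.
by rewrite addn0 ltn_neqAle => ->; rewrite andbT (inj_eq (@letter_rank_inj n)).
Qed.

Variables (F : fieldType) (x y : 'I_n -> F) (z0 : F).

Lemma wgt_partial_tableau eps P :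
    partial_tableau (diag_rank eps) max_rank full_shape P ->
  wgt x y z0 P = (\prod_(i < n) diag_wgt x y z0 (nth Zero (diag eps) i, false)) *
    \prod_(b | inside full_shape b && (0 < tagged b)%N) offdiag_wgt x y z0 (P b).
Proof.
case/partial_tableauP => _ dP _ _.
rewrite /wgt (bigID (fun b : box lam => on_diag b)) /=; congr (_ * _); last first.
  apply: eq_big => b; first by rewrite inside_full on_diagE lt0n.
  by move=> /negbTE ->.
transitivity (\prod_i \prod_(p < tnth lam i | p == 0%N :> nat)
    diag_wgt x y z0 (nth Zero (diag eps) i, false)).
  rewrite sig_big_dep /=; apply: eq_big => b; first by rewrite on_diagE.
  move=> db; rewrite db; congr diag_wgt; apply: letter_rank_inj.
  by rewrite letter_rank_unprimed dP ?inside_full //; apply/eqP; rewrite -on_diagE.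
by apply: eq_bigr => i _; rewrite (big_pred1 (Ordinal (part_gt0 i))).
Qed.

Lemma sum_tableaux_diag eps :
  \sum_(P : filling lam | tableau P && (barred P == eps)) wgt x y z0 P =
  rows_det (row_coef x y z0) (fun j => tnth lam j) (diag eps).
Proof.
pose W := offdiag_wgt x y z0.
transitivity ((\prod_(i < n) diag_wgt x y z0 (nth Zero (diag eps) i, false)) *
    partial_sum lam W (diag_rank eps) max_rank full_shape).
  rewrite /partial_sum mulr_sumr; apply: eq_big => P; last first.
    by case/andP => tP /eqP /(tableau_partial_full tP); exact: wgt_partial_tableau.
  apply/idP/idP => [/andP[tP /eqP]|]; first exact: tableau_partial_full.
  exact: partial_full_tableau.
rewrite partial_sum_det //; first last.
- by apply: stage_full => i; exact: diag_rank_max.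
- by move=> i; rewrite ffunE.
- exact: diag_rank_mono.
- exact: diag_rank_odd.
(* The diagonal weights become factors of the rows. *)
have -> : \prod_(i < n) diag_wgt x y z0 (nth Zero (diag eps) i, false) =
    \det (diag_mx (\row_(i < n) diag_wgt x y z0 (nth Zero (diag eps) i, false))).
  by rewrite det_diag; apply: eq_bigr => i _; rewrite mxE.
rewrite -det_mulmx mul_diag_mx; congr (\det _); apply/matrixP => i j; rewrite !mxE.
by rewrite diag_rank_max ffunE.
Qed.

End Grouping.

Theorem theorem5 (n : nat) (F : fieldType) (x y : 'I_n -> F) (z0 : F)
    (lam : n.-tuple nat) :
  (forall i, x i != 0) -> (forall i, y i != 0) -> z0 != 0 ->
  strict_partition lam ->
  \sum_(P : filling lam | tableau P) wgt x y z0 P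
  = fcoef (\det (\matrix_(k < n, l < n) h_ x y z0 k l)) [multinom lam].
Proof.
move=> _ _ _ lam_strict.
(* Tableaux are grouped by the set of [k] with kbar on the main diagonal, matching the row choices
   in the determinant. *)
rewrite (partition_big (@barred n lam) xpredT) //=.
have -> : \matrix_(k < n, l < n) h_ x y z0 k l = \matrix_(k < n, l < n) in_var l
    (fun p => row_coef x y z0 (Unbar k) p + (-1) ^+ (n - k.+1) * row_coef x y z0 (Bar k) p).
  by apply/matrixP => k l; rewrite !mxE h_E.
rewrite (fcoef_det_in_var (fun k p => row_coef x y z0 (Unbar k) p +
  (-1) ^+ (n - k.+1) * row_coef x y z0 (Bar k) p)) det_two_rows.
by apply: eq_bigr => eps _; rewrite sum_tableaux_diag //.
Qed.
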